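(* Let $E$ be a nonempty set of cardinals contained in the interval $[\omega,\mathfrak{c}]$. For each $\kappa\in E$, fix a non-zero cardinal $\mu_\kappa\le\mathfrak{c}$. Assume that either $|E|>1$, or $E=\{\kappa\}$ with $\mu_\kappa>1$. Then there exists a zero-dimensional, monothetic, and free subgroup $G$ of $\mathbb{T}^{\mathfrak{c}}$ such that $QW(G)=E$ and, for each $\kappa\in E$, $G$ has exactly $\mu_\kappa$ many proper quotient groups of weight $\kappa$.
   Context: $\mathbb{T}$ is the one-dimensional torus (circle group), $\mathbb{T}^{\mathfrak{c}}$ carries the product topology, and subgroups carry the subspace topology; $\mathfrak{c}=2^\omega$. The weight $w(X)$ of a space is the least cardinality of a base. For a precompact abelian group $G$, a quotient group is $G/N$ with $N$ a closed subgroup, with the quotient topology; it is called proper if $N$ is non-trivial; quotient groups are counted according to the closed subgroups $N$. $QW(G)=\{w(K): K \text{ is an infinite proper quotient group of } G\}$. (Precompact: for every neighborhood $U$ of the identity there is a finite set $F$ with $G=F+U$; every subgroup of $\mathbb{T}^{\mathfrak{c}}$ is precompact.) A topological group is monothetic if it has a dense cyclic subgroup. ''Free'' means free abelian as an abstract group. Zero-dimensional means having a base of clopen sets. *)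

(* Defs.v *)
From HB Require Import structures.
From mathcomp Require Import all_boot all_order all_algebra.
From mathcomp Require Import complex.
From mathcomp Require Import all_classical all_reals all_analysis.

Set Implicit Arguments.
Unset Strict Implicit.
Unset Printing Implicit Defensive.

Import Order.TTheory GRing.Theory Num.Theory.
Import numFieldNormedType.Exports.

Local Open Scope classical_set_scope.
Local Open Scope ring_scope.

(* A cardinal is an equipotence class of types, so that equality of cardinals
   is Leibniz equality and sets of cardinals make sense.                      *)
Definition cardinal :=
  {C : set Type | exists K : Type, C = [set L | ([set: L] #= [set: K])%card]}.

Definition cardinality (K : Type) : cardinal :=
  exist _ [set L | ([set: L] #= [set: K])%card] (ex_intro _ K erefl).

Definition cardinal_le (k l : cardinal) :=
  exists K L : Type, [/\ k = cardinality K, l = cardinality L &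
                         ([set: K] #<= [set: L])%card].

Definition cardinal_lt (k l : cardinal) := cardinal_le k l /\ k <> l.

Definition aleph0 : cardinal := cardinality nat.

Definition continuum : cardinal := cardinality (nat -> bool).

Lemma cardinalityP (K L : Type) :
  cardinality K = cardinality L <-> ([set: K] #= [set: L])%card.
Proof.
split=> [/(congr1 (@proj1_sig _ _))/= /predeqP/(_ K) [+ _]|KL].
  by apply; exact: card_eqxx.
apply: eq_sig_hprop => [C|/=]; first exact: Prop_irrelevance.
by apply/predeqP => M /=; rewrite (card_eqr KL).
Qed.

Lemma cardinal_leP (K L : Type) :
  cardinal_le (cardinality K) (cardinality L) <->
  ([set: K] #<= [set: L])%card.
Proof.
split=> [[K' [L' [/cardinalityP KK' /cardinalityP LL' K'L']]]|KL]; last first.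
  by exists K, L.
by rewrite (card_le_eql KK') (card_le_eqr LL').
Qed.

Lemma numField_div_continuous (K : numFieldType) (X : topologicalType)
    (f g : X -> K^o) :
  continuous f -> continuous g -> (forall x, g x != 0) ->
  continuous (fun x => f x * (g x)^-1 : K^o).
Proof.
move=> cf cg g0 x.
apply: (@cvgM K _ (nbhs x) _ f (fun y => (g y)^-1)); first exact: cf.
by apply: (@cvgV K _ (nbhs x) _ g); [exact: g0|exact: cg].
Qed.

(* The circle group, written additively: [x + y] is the product of the complex
   numbers [x] and [y].                                                       *)
Section circle.
Variable R : realType.

Record circle := Circle { circle_val :> R[i]; _ : `|circle_val| == 1 }.

HB.instance Definition _ := [isSub for circle_val].
HB.instance Definition _ := [Choice of circle by <:].

Implicit Types x y z : circle.

Fact circle0_subproof : `|1 : R[i]| == 1. Proof. by rewrite normr1. Qed.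

Fact circleD_subproof x y : `|val x * val y| == 1.
Proof. by rewrite normrM (eqP (valP x)) (eqP (valP y)) mulr1. Qed.

Fact circleN_subproof x : `|(val x)^-1| == 1.
Proof. by rewrite normfV (eqP (valP x)) invr1. Qed.

Definition circle0 : circle := Circle circle0_subproof.
Definition circleD x y : circle := Circle (circleD_subproof x y).
Definition circleN x : circle := Circle (circleN_subproof x).

Fact circle_addA : associative circleD.
Proof. by move=> x y z; apply/val_inj; rewrite /= mulrA. Qed.

Fact circle_addC : commutative circleD.
Proof. by move=> x y; apply/val_inj; rewrite /= mulrC. Qed.

Fact circle_add0 : left_id circle0 circleD.
Proof. by move=> x; apply/val_inj; rewrite /= mul1r. Qed.

Fact circle_addN : left_inverse circle0 circleN circleD.
Proof.
move=> x; apply/val_inj; rewrite /= mulVf// -normr_eq0.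
by rewrite (eqP (valP x)) oner_eq0.
Qed.

HB.instance Definition _ :=
  GRing.isZmodule.Build circle circle_addA circle_addC circle_add0 circle_addN.

HB.instance Definition _ :=
  Topological.copy circle (initial_topology (fun z : circle => val z : R[i]^o)).

Fact circle_sub_continuous : continuous (fun x : circle * circle => x.1 - x.2).
Proof.
apply: (@continuous_comp_initial circle _ _
  (fun z : circle => val z : R[i]^o)).
have cval : continuous (fun z : circle => val z : R[i]^o).
  exact: initial_continuous.
have val_neq0 (z : circle) : val z != 0.
  by rewrite -normr_eq0 (eqP (valP z)) oner_eq0.
apply: (@numField_div_continuous R[i] (circle * circle)%type
  (fun y : circle * circle => val y.1) (fun y : circle * circle => val y.2)) => y.
- by apply: continuous_comp; [exact: cvg_fst|exact: cval].
- by apply: continuous_comp; [exact: cvg_snd|exact: cval].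
- exact: val_neq0.
Qed.

HB.instance Definition _ :=
  PreTopologicalNmodule_isTopologicalZmodule.Build circle circle_sub_continuous.

End circle.

HB.instance Definition _ (I : Type) (V : zmodType) :=
  GRing.Zmodule.copy {ptws I -> V} (I -> V).

Section ptws.
Variables (I : Type) (V : topologicalZmodType).

Fact ptws_sub_continuous :
  continuous (fun x : {ptws I -> V} * {ptws I -> V} => x.1 - x.2).
Proof.
move=> x; apply/cvg_sup => i.
have cproj : continuous (fun f : {ptws I -> V} => f i).
  move=> f; have /cvg_sup/(_ i) cf : f --> f by exact: cvg_id.
  apply: cvg_trans; first exact: (cvg_app (fun f : {ptws I -> V} => f i) cf).
  exact: initial_continuous.
pose W := initial_topology (fun f : I -> V => f i).
suff : continuous (fun x : {ptws I -> V} * {ptws I -> V} => (x.1 - x.2 : W)).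
  exact.
apply: (@continuous_comp_initial _ _ _ (fun f : I -> V => f i)) => y /=.
apply: (@continuous_comp _ _ _
  (fun y : {ptws I -> V} * {ptws I -> V} => (y.1 i, y.2 i))
  (fun z : V * V => z.1 - z.2)); last exact: sub_continuous.
apply: cvg_pair.
  apply: (@continuous_comp _ _ _ fst (fun f : {ptws I -> V} => f i)).
    exact: cvg_fst.
  exact: cproj.
apply: (@continuous_comp _ _ _ snd (fun f : {ptws I -> V} => f i)).
  exact: cvg_snd.
exact: cproj.
Qed.

HB.instance Definition _ :=
  PreTopologicalNmodule_isTopologicalZmodule.Build {ptws I -> V}
    ptws_sub_continuous.

End ptws.

Section subgroup.
Variables (V : topologicalZmodType) (G : zmodClosed V).

Definition subgroup : Type := {x : V | x \in G}.

HB.instance Definition _ := SubChoice.on subgroup.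
HB.instance Definition _ := [SubChoice_isSubZmodule of subgroup by <:].
HB.instance Definition _ :=
  Topological.copy subgroup (initial_topology (val : subgroup -> V)).

Fact subgroup_sub_continuous :
  continuous (fun x : subgroup * subgroup => x.1 - x.2).
Proof.
apply: (@continuous_comp_initial subgroup _ _ (val : subgroup -> V)) => x.
have cval : continuous (val : subgroup -> V) by exact: initial_continuous.
rewrite /continuous_at /=.
apply: (@continuous_comp _ _ _
  (fun y : subgroup * subgroup => (val y.1, val y.2))
  (fun z : V * V => z.1 - z.2)); last exact: sub_continuous.
apply: cvg_pair.
  by apply: continuous_comp; [exact: cvg_fst|exact: cval].
by apply: continuous_comp; [exact: cvg_snd|exact: cval].
Qed.

HB.instance Definition _ :=
  PreTopologicalNmodule_isTopologicalZmodule.Build subgroup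
    subgroup_sub_continuous.

End subgroup.

Definition is_weight (X : topologicalType) (k : cardinal) :=
  (exists2 B : set (set X), basis B & cardinality B = k) /\
  (forall B : set (set X), basis B -> cardinal_le k (cardinality B)).

(* Not [zero_dimensional], which only asks that clopen sets separate points.  *)
Definition has_clopen_basis (X : topologicalType) :=
  exists2 B : set (set X), basis B & B `<=` clopen.

Definition monothetic (V : topologicalZmodType) :=
  exists x : V, dense (range (fun n : int => x *~ n)).

Definition free_abelian (V : zmodType) :=
  exists B : set V,
    (forall x, exists (s : seq V) (c : V -> int),
       [set` s] `<=` B /\ x = \sum_(b <- s) b *~ c b) /\
    (forall (s : seq V) (c : V -> int), uniq s -> [set` s] `<=` B ->
       \sum_(b <- s) b *~ c b = 0 -> {in s, forall b, c b = 0}).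

Definition quotient_group (V : topologicalZmodType) (N : zmodClosed V)
  : topologicalType := quotient_topology (Quotient.quot N).

Definition proper_kernel (V : topologicalZmodType) (N : zmodClosed V) :=
  closed [set` N] /\ exists2 x, x \in N & x != 0.

Definition QW (V : topologicalZmodType) : set cardinal :=
  [set k | exists N : zmodClosed V,
    [/\ proper_kernel N, infinite_set [set: quotient_group N] &
        is_weight (quotient_group N) k]].

(* The kernels are counted as subsets of [V]; the structure [N] carried by such
   a subset only adds the proofs of closure under the group operations.       *)
Definition proper_kernels_of_weight (V : topologicalZmodType) (k : cardinal)
  : set (set V) :=
  [set A | exists N : zmodClosed V,
    [/\ A = [set` N], proper_kernel N & is_weight (quotient_group N) k]].

Arguments proper_kernels_of_weight : clear implicits.

(* Main.v *)
Require Import Defs.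
From HB Require Import structures.
From mathcomp Require Import all_boot all_order all_algebra.
From mathcomp Require Import complex.
From mathcomp Require Import all_classical wochoice all_reals all_analysis.
From mathcomp Require Import ring lra zify.

(** Let [X = nat -> bool]. The group is generated inside [circle ^ X] by elements
built from one topological generator of the torus [circle ^ X]: a family
[y : X -> R] such that the integer multiples of [(cis (y z))_z] come close to
any prescribed values at any finitely many [z] (lemma [kronecker_density]).

The pairs [(k, m)] with [k] in [E] and [m] below [mu k] are coded by the
elements [j] of a set [J] of points of [X], and each [j] coding [(k, m)] comes
with a set [I j] of cardinality [k]. The coordinate of the torus coded by
[(j, i)], with [j] in [J] and [i] in [I j], is said to be owned by [j]; the
other coordinates play no role. The generator attached to [j] vanishes at the
coordinates owned by [j], and takes the value [cis (y (x, j))] at any other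
owned coordinate [x]. The group [G] consists of the finite integral
combinations of these generators.

A combination with coefficients [c] can vanish at [x] only if [c j = 0] for
every [j] other than the owner of [x]. The numbers [y] being used at most once,
multiples of a fixed element of [G] take values close to arbitrary ones at any
finitely many coordinates where this element does not vanish (lemma
[kronecker_gspan]). All properties of [G] follow.
- The generators are linearly independent, so [G] is free.
- The sum of two generators vanishes at no owned coordinate, so its multiples
  are dense. This needs two elements in [J], which is what the alternative
  between [|E| > 1] and [mu k > 1] provides.
- No nonzero value of an element of [G] is a torsion point, so a disc centered
  at such a value has a clopen preimage if its radius is the distance from zero
  to a nonzero torsion point.
- The closure of the subgroup generated by [g] contains every [h] vanishing
  wherever [g] does. Hence the nontrivial closed subgroups are [G] and, for
  each [j] in [J], the axis of [j], i.e., the multiples of the generator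
  attached to [j] (lemma [closed_subgroupP]).
- Multiples of the generator of [j] correct the coordinates not owned by [j],
  so the quotient of [G] by the axis of [j] carries the topology of pointwise
  convergence on the coordinates owned by [j]. Since a neighborhood of zero
  constrains only finitely many coordinates, its weight is the cardinality of
  [I j] (lemma [axis_weight]).

The coding rests on two facts about cardinals: an infinite set is equipotent to
the set of its finite sequences, and, thanks to a well-ordering of [X], there
are at most continuum many cardinals not exceeding the continuum. *)

Set Implicit Arguments.
Unset Strict Implicit.
Unset Printing Implicit Defensive.

Import Order.TTheory GRing.Theory Num.Theory.
Import numFieldNormedType.Exports.

Local Open Scope classical_set_scope.
Local Open Scope card_scope.

(** * Cardinal arithmetic *)

Lemma card_le_injP (T U : Type) :
  [set: T] #<= [set: U] <-> exists f : T -> U, injective f.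
Proof.
split=> [/card_leP/injfunPex[f _ fI]|[f fI]].
  exists (fun x => set_val (f (to_setT x))) => x y.
  move=> /val_inj /fI.
  by rewrite !inE => /(_ Logic.I Logic.I) /(congr1 set_val).
have [g] : $|{injfun [set: T] >-> [set: U]}|.
  by apply/injfunPex; exists f => // x y _ _ /fI.
exact: inj_card_le.
Qed.

Lemma sval_inj (T : Type) (P : T -> Prop) : injective (@sval T P).
Proof. by move=> [x Px] [y Py] /= xy; exact: eq_exist. Qed.

(** Comparability of cardinals: a maximal partial bijection is total on one of
    the two sides. *)
Lemma card_le_total (T U : Type) :
  (exists f : T -> U, injective f) \/ (exists g : U -> T, injective g).
Proof.
pose P (G : set (T * U)) :=
  (forall x y y', G (x, y) -> G (x, y') -> y = y') /\
  (forall x x' y, G (x, y) -> G (x', y) -> x = x').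
have [F FP Ftot|M [[M1 M2] Mmax]] := @Zorn_bigcup _ P.
  split=> [x y y'|x x' y] [G FG Gx] [G' FG' Gx'].
    by have [/(_ _ Gx) ?|/(_ _ Gx') ?] := Ftot _ _ FG FG';
      [apply: (FP _ FG').1; eauto|apply: (FP _ FG).1; eauto].
  by have [/(_ _ Gx) ?|/(_ _ Gx') ?] := Ftot _ _ FG FG';
    [apply: (FP _ FG').2; eauto|apply: (FP _ FG).2; eauto].
have [/choice[f Mf]|/existsNP[x0 Nx0]] := pselect (forall x, exists y, M (x, y)).
  by left; exists f => x x' fE; apply: (M2 _ _ (f x)) => //; rewrite fE.
have [/choice[g Mg]|/existsNP[y0 Ny0]] := pselect (forall y, exists x, M (x, y)).
  by right; exists g => y y' gE; apply: (M1 (g y)) => //; rewrite gE.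
exfalso; apply: (Mmax (M `|` [set (x0, y0)])).
  split; first by apply: subsetUl.
  move=> /(_ (x0, y0)) /(_ (or_intror erefl)) Mxy.
  by apply: Nx0; exists y0.
split=> [x y y'|x x' y] [Mxy|[xE yE]] [Mxy'|[xE' yE']]; subst => //.
- exact: M1 Mxy Mxy'.
- by case: Nx0; exists y.
- by case: Nx0; exists y'.
- exact: M2 Mxy Mxy'.
- by case: Ny0; exists x.
- by case: Ny0; exists x'.
Qed.

(** An infinite type [T] admits an injection [T * T -> T]. Zorn's lemma yields a
    maximal graph of an injection [A * A -> A]; if the complement of [A] did
    not embed into [A], a copy of [A] inside this complement would allow the
    graph to be extended. *)
Section hessenberg.
Variables (T : Type) (i : nat -> T).
Hypothesis i_inj : injective i.

Let dom (G : set (T * T * T)) : set T := [set a | exists z, G (a, a, z)].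

(* [G] is the graph of an injection [A * A -> A] with [A = dom G] *)
Let good (G : set (T * T * T)) := [/\
  forall p z z', G (p, z) -> G (p, z') -> z = z',
  forall p p' z, G (p, z) -> G (p', z) -> p = p',
  forall a b z, G (a, b, z) -> [/\ dom G a, dom G b & dom G z] &
  forall a b, dom G a -> dom G b -> exists z, G (a, b, z)].

(* The seed [G0] makes every graph considered below have an infinite domain;
   graphs are of the form [G0 `|` G], which also covers the empty chain. *)
Let G0 : set (T * T * T) :=
  [set t | exists m n : nat, t = (i m, i n, i (pickle (m, n)))].

Let G0_dom n : dom G0 (i n).
Proof. by exists (i (pickle (n, n))), n, n. Qed.

Let good0 : good G0.
Proof.
split.
- by move=> p z z' [m [n [-> ->]]] [m' [n' [/i_inj -> /i_inj -> ->]]].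
- move=> p p' z [m [n [-> ->]]] [m' [n' [-> /i_inj]]].
  by move=> /(pcan_inj pickleK) [-> ->].
- by move=> a b z [m [n [-> -> ->]]]; split; apply: G0_dom.
- move=> a b [_ [m [n [-> _ _]]]] [_ [m' [n' [-> _ _]]]].
  by exists (i (pickle (m, m'))), m, m'.
Qed.

Let dom_sub (G H : set (T * T * T)) : G `<=` H -> dom G `<=` dom H.
Proof. by move=> GH a [z] /GH ?; exists z. Qed.

Let chain (F : set (set (T * T * T))) :
  F `<=` [set G | good (G0 `|` G)] -> total_on F subset ->
  good (G0 `|` \bigcup_(X in F) X).
Proof.
move=> Fgood Ftot; set U := G0 `|` _.
have key u v : U u -> U v ->
    exists G, [/\ good G, G `<=` U, G u & G v].
  have bigU X : F X -> G0 `|` X `<=` U by move=> FX; apply: setUS; exact: bigcup_sup.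
  move=> [u0|[X FX Xu]] [v0|[Y FY Yv]].
  - by exists G0; split => //; exact: subsetUl.
  - by exists (G0 `|` Y); split; [exact: Fgood|exact: bigU|left|right].
  - by exists (G0 `|` X); split; [exact: Fgood|exact: bigU|right|left].
  - have [XY|YX] := Ftot _ _ FX FY.
      by exists (G0 `|` Y); split; [exact: Fgood|exact: bigU|right; exact: XY|right].
    by exists (G0 `|` X); split; [exact: Fgood|exact: bigU|right|right; exact: YX].
split.
- by move=> p z z' Uz /(key _ _ Uz)[G [[G1 _ _ _] _ /G1]]; apply.
- by move=> p p' z Uz /(key _ _ Uz)[G [[_ G1 _ _] _ /G1]]; apply.
- move=> a b z /[dup] Ua /(key _ _ Ua) [G [[_ _ G1 _] GU /G1[Ga Gb Gz] _]].
  by split; exact: dom_sub GU _ _.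
- move=> a b [z Ua] [z' Ub]; have [G [[_ _ _ G1] GU Ga Gb]] := key _ _ Ua Ub.
  by have [||y Gy] := G1 a b; [exists z|exists z'|exists y; exact: GU].
Qed.

Lemma pairing_exists : exists p : T * T -> T, injective p.
Proof.
have [F FP Ftot|M [Mgood Mmax]] := @Zorn_bigcup _ [set G | good (G0 `|` G)].
  exact: chain.
set G := G0 `|` M in Mgood; have [G1 G2 G3 G4] := Mgood.
pose A := dom G.
have Ai n : A (i n) by apply: dom_sub (G0_dom n); exact: subsetUl.
have [p pP] : exists p : T -> T -> T, forall a b, A a -> A b -> G (a, b, p a b).
  have : forall ab : T * T, exists z, A ab.1 -> A ab.2 -> G (ab.1, ab.2, z).
    move=> [a b] /=.
    have [[Aa Ab]|nAB] := pselect (A a /\ A b).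
      by have [z] := G4 _ _ Aa Ab; exists z.
    by exists a => *; case: nAB.
  by move=> /choice[p pP]; exists (fun a b => p (a, b)) => a b; exact: (pP (a, b)).
have pA a b : A a -> A b -> A (p a b).
  by move=> Aa Ab; have [] := G3 _ _ _ (pP _ _ Aa Ab).
have pI a b a' b' : A a -> A b -> A a' -> A b' -> p a b = p a' b' ->
    a = a' /\ b = b'.
  move=> Aa Ab Aa' Ab' pE; have := pP _ _ Aa Ab; rewrite pE => h.
  by have [-> ->] := G2 _ _ _ h (pP _ _ Aa' Ab').
(* either the complement of [A] embeds into [A], whence [T] does, or [A] embeds
   into its complement *)
have [[c cI]|[j jI]] := card_le_total {x | ~ A x} {x | A x}.
  have kE x : exists y, (A x /\ y = p (i 0) x) \/
      (exists h : ~ A x, y = p (i 1) (sval (c (exist _ x h)))).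
    have [Ax|Ax] := pselect (A x); first by exists (p (i 0) x); left.
    by exists (p (i 1) (sval (c (exist _ x Ax)))); right; exists Ax.
  have [k kP] := choice kE.
  have cA y : A (sval (c y)) by case: (c y).
  have kA x : A (k x).
    by have [[Ax ->]|[h ->]] := kP x; apply: pA.
  have kI : injective k.
    move=> x y kxy; case: (kP x) (kP y) => [[Ax]|[hx]] + [[Ay]|[hy]];
      rewrite kxy => -> /pI.
    - by case.
    - by move=> /(_ (Ai _) Ax (Ai _) (cA _)) [/i_inj].
    - by move=> /(_ (Ai _) (cA _) (Ai _) Ay) [/i_inj].
    - by move=> /(_ (Ai _) (cA _) (Ai _) (cA _)) [_] /sval_inj /cI/(congr1 sval).
  exists (fun ab => p (k ab.1) (k ab.2)) => -[a b] [a' b'] /=.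
  by move=> /pI[]// /kI -> /kI ->.
exfalso.
have ExA : exists e : T -> T, (forall a, A a -> ~ A (e a)) /\
    (forall a b, A a -> A b -> e a = e b -> a = b).
  have eE x : exists y, forall Ax : A x, y = sval (j (exist _ x Ax)).
    have [Ax|Ax] := pselect (A x); last by exists x => Ax'; case: (Ax Ax').
    exists (sval (j (exist _ x Ax))) => Ax'.
    by congr (sval (j _)); exact: eq_exist.
  have [e eP] := choice eE; exists e; split=> [a Aa|a b Aa Ab].
    by rewrite (eP _ Aa); case: (j _).
  rewrite (eP _ Aa) (eP _ Ab) => E.
  by have /(congr1 sval) := jI _ _ (sval_inj E).
have {j jI} [e [eA eI]] := ExA.
(* [t false a = a] and [t true a = e a] parametrize [A `|` e @` A]; the pairs
   outside [A * A] are those [(t s a, t s' b)] with [s || s'], and they are sent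
   into [e @` A], tagged by [(s, s')] *)
pose t (s : bool) a := if s then e a else a.
have tI s s' a a' : A a -> A a' -> t s a = t s' a' -> s = s' /\ a = a'.
  case: s s' => [] [] //= Aa Aa' E; first by split=> //; exact: eI.
  - by case: (eA _ Aa); rewrite E.
  - by case: (eA _ Aa'); rewrite -E.
pose c s s' a b := e (p (i (pickle (s : bool, s' : bool))) (p a b)).
have cA s s' a b : A a -> A b -> ~ A (c s s' a b).
  by move=> Aa Ab; apply/eA/pA => //; exact: pA.
have cI s s' a b u u' a' b' : A a -> A b -> A a' -> A b' ->
    c s s' a b = c u u' a' b' -> [/\ s = u, s' = u', a = a' & b = b'].
  move=> Aa Ab Aa' Ab' E; have := eI _ _ (pA _ _ (Ai _) (pA _ _ Aa Ab))
    (pA _ _ (Ai _) (pA _ _ Aa' Ab')) E.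
  move=> /(pI _ _ _ _ (Ai _) (pA _ _ Aa Ab) (Ai _) (pA _ _ Aa' Ab')).
  move=> [/i_inj/(pcan_inj pickleK) ss' /(pI _ _ _ _ Aa Ab Aa' Ab') [-> ->]].
  by case: ss' => -> ->.
pose new : set (T * T * T) := [set x | exists s s' a b,
  [/\ s || s', A a, A b & x = (t s a, t s' b, c s s' a b)]].
have domE x : dom (G `|` new) x -> exists s a, A a /\ x = t s a.
  move=> [z [/G3[Ax _ _]|[s [s' [a [b [_ Aa Ab [-> _ _]]]]]]]].
    by exists false, x.
  by exists s, a.
have domt s a : A a -> dom (G `|` new) (t s a).
  move=> Aa; case: s; last by have [z ?] := Aa; exists z; left.
  by exists (c true true a a); right; exists true, true, a, a.
have GA p0 z : G (p0, z) -> A p0.1 /\ A p0.2.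
  by case: p0 => a b /G3[].
have tA s a : A a -> A (t s a) -> s = false.
  by case: s => //= /eA.
apply: (Mmax (M `|` new)).
  split; first exact: subsetUl.
  move=> /(_ (e (i 0), e (i 0), c true true (i 0) (i 0))) h.
  have /G3[/(eA _ (Ai 0))//] : G (e (i 0), e (i 0), c true true (i 0) (i 0)).
  by right; apply: h; right; exists true, true, (i 0), (i 0).
change (good (G0 `|` (M `|` new))); rewrite setUA -/G; split.
- move=> q z z' [Gz|[s [s' [a [b [ss Aa Ab E]]]]]]
    [Gz'|[u [u' [a' [b' [uu Aa' Ab' E']]]]]].
  + exact: G1 Gz Gz'.
  + exfalso; have [] := GA _ _ Gz; case: E' => -> _ /= /(tA _ _ Aa') uE /(tA _ _ Ab') u'E.
    by move: uu; rewrite uE u'E.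
  + exfalso; have [] := GA _ _ Gz'; case: E => -> _ /= /(tA _ _ Aa) sE /(tA _ _ Ab) s'E.
    by move: ss; rewrite sE s'E.
  + move: E E'; case: q => q1 q2 [-> -> ->] [E1 E2 ->].
    have [-> ->] := tI _ _ _ _ Aa Aa' E1.
    by have [-> ->] := tI _ _ _ _ Ab Ab' E2.
- move=> q q' z [Gz|[s [s' [a [b [ss Aa Ab [-> E]]]]]]]
    [Gz'|[u [u' [a' [b' [uu Aa' Ab' [-> E']]]]]]].
  + exact: G2 Gz Gz'.
  + by exfalso; case: q Gz => q1 q2 /G3[_ _]; rewrite E' => /(cA _ _ _ _ Aa' Ab').
  + by exfalso; case: q' Gz' => q1 q2 /G3[_ _]; rewrite E => /(cA _ _ _ _ Aa Ab).
  + by move: E'; rewrite E => /(cI _ _ _ _ _ _ _ _ Aa Ab Aa' Ab')[-> -> -> ->].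
- move=> a b z [/G3[Aa Ab Az]|[s [s' [a' [b' [ss Aa Ab [-> -> ->]]]]]]].
    by split; [exact: (domt false)|exact: (domt false)|exact: (domt false)].
  split; [exact: domt|exact: domt|].
  apply: (domt true); exact: pA (Ai _) (pA _ _ Aa Ab).
- move=> _ _ /domE[s [a [Aa ->]]] /domE[s' [b [Ab ->]]].
  have [ss|] := boolP (s || s').
    by exists (c s s' a b); right; exists s, s', a, b.
  rewrite negb_or; case: s s' => [] [] //= _.
  by have [z ?] := G4 _ _ Aa Ab; exists z; left.
Qed.

End hessenberg.

Lemma infinite_injP (T : Type) :
  infinite_set [set: T] <-> exists i : nat -> T, injective i.
Proof. by rewrite infiniteP card_le_injP. Qed.

(** An infinite type absorbs finite sequences and countable factors. *)
Lemma seq_code_exists (T : Type) (C : countType) :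
  infinite_set [set: T] -> exists f : seq (T * C) * C -> T, injective f.
Proof.
move=> /infinite_injP[i iI]; have [p pI] := pairing_exists iI.
pose g (x : T * C) := p (x.1, i (pickle x.2)).
have gI : injective g.
  move=> [t c] [t' c'] /pI [-> /iI /(pcan_inj pickleK) ->] //.
pose h := foldr (fun x t => p (g x, t)) (i 0).
have hI s s' : size s = size s' -> h s = h s' -> s = s'.
  elim: s s' => [[]//|x s IH] [//|y s'] [/IH {}IH] /=.
  by move=> /pI[/gI -> /IH ->].
exists (fun sc => p (i (size sc.1), p (h sc.1, i (pickle sc.2)))).
move=> [s c] [s' c'] /= /pI[/iI /hI {}hI /pI[/hI ->]].
by move=> /iI/(pcan_inj pickleK) ->.
Qed.

(** Proved by pairing [f x] with the index of [x] in its fiber, [B] being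
    necessarily infinite. *)
Lemma finite_fibers_inj (I B : Type) (f : I -> B) :
  infinite_set [set: I] -> (forall b, finite_set (f @^-1` [set b])) ->
  exists g : I -> B, injective g.
Proof.
move=> Iinf ffin.
have Binf : infinite_set [set: B].
  move=> Bfin; apply: Iinf; have -> : [set: I] = \bigcup_(b in [set: B]) f @^-1` [set b].
    by apply/seteqP; split=> // x _; exists (f x).
  by apply: bigcup_finite => // b _; exact: ffin.
have [i iI] := (infinite_injP B).1 Binf; have [p pI] := pairing_exists iI.
have [j jP] : exists j : B -> I -> nat, forall b x y, f x = b -> f y = b ->
    j b x = j b y -> x = y.
  have jE b : exists j : I -> nat, {in f @^-1` [set b] &, injective j}.
    by apply/pcard_injP/finite_set_countable.
  have [j jP] := choice jE; exists j => b x y xb yb.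
  by apply: jP; rewrite inE.
exists (fun x => p (f x, i (j (f x) x))) => x y /pI[fE /iI].
by rewrite fE; apply: jP.
Qed.

(** Given a well-ordering of [X], a subset [A] of [X] is coded by the least [x]
    such that [A] embeds into the initial segment of [x], or by [None] if there
    is no such [x]. *)
Section cardinal_code.
Variables (X : eqType) (R : rel X).
Hypothesis woR : well_order R.

Let lt x y := R x y && (x != y).

Let Rtot x y : R x y || R y x.
Proof.
have [|z [[zin zmin] _]] := woR (A := [pred t | (t == x) || (t == y)]).
  by exists x; rewrite inE eqxx.
have /= := zin; rewrite inE => /orP[/eqP zE|/eqP zE]; subst z.
  by rewrite zmin// inE eqxx orbT.
by rewrite [R y x]zmin ?orbT// inE eqxx.
Qed.

Let Ranti x y : R x y -> R y x -> x = y.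
Proof.
move=> xy yx; have [|z [[zin zmin] zU]] := woR (A := [pred t | (t == x) || (t == y)]).
  by exists x; rewrite inE eqxx.
have xx : R x x by have := Rtot x x; rewrite orbb.
have yy : R y y by have := Rtot y y; rewrite orbb.
have min u : u = x \/ u = y -> R u x -> R u y ->
    minimum_of R [pred t | (t == x) || (t == y)] u.
  move=> uxy ux uy; split; first by rewrite inE; case: uxy => ->; rewrite eqxx ?orbT.
  by move=> t; rewrite inE => /orP[]/eqP->.
by rewrite -(zU x (min x _ _ _)) ?(zU y (min y _ _ _)) //; [right|left].
Qed.

Let ex_min (A : set X) : A !=set0 ->
  exists2 x, A x & forall y, lt y x -> ~ A y.
Proof.
move=> [a Aa]; have [|z [[zin zmin] _]] := woR (A := [pred t | `[< A t >]]).
  by exists a; apply/asboolP.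
exists z; first by move: zin => /asboolP.
move=> y /andP[yz]; apply: contraNnot => Ay; apply/eqP/Ranti => //.
by apply: zmin; apply/asboolP.
Qed.

Let lt_wf : well_founded lt.
Proof.
move=> x; apply: contrapT => nx.
have [z nz zmin] := ex_min (A := [set x | ~ Acc lt x]) (ex_intro _ x nx).
by apply: nz; constructor => y /zmin /contrapT.
Qed.

Let lt_total x y : x <> y -> lt x y \/ lt y x.
Proof.
move=> /eqP xy; rewrite /lt xy eq_sym xy !andbT.
by have /orP := Rtot x y.
Qed.

(** The type [K] embeds into the proper initial segment of [x]. *)
Definition embeds_below (K : Type) x :=
  exists f : K -> X, injective f /\ forall k, lt (f k) x.

(** The injection is built by well-founded recursion: the values taken below
    [x] cannot exhaust [K]. *)
Lemma embeds_of_not_below (K : Type) (D : set X) :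
  (forall x, D x -> ~ embeds_below K x) ->
  exists f : {x | D x} -> K, injective f.
Proof.
move=> DK; have [[k0]|K0] := pselect (inhabited K); last first.
  have D0 x : ~ D x.
    move=> /DK; apply; have f (k : K) : X by case: K0.
    by exists f; split=> k; case: K0.
  have f (x : {x | D x}) : K by case: x => x Dx; case: (D0 x Dx).
  by exists f => -[x Dx]; case: (D0 x Dx).
pose F x (rec : forall y, lt y x -> K) : K :=
  xget (k0 : {classic K}) [set k | forall y (yx : lt y x), rec y yx <> k].
pose f := Fix lt_wf (fun=> K) F.
have fE x : f x = xget (k0 : {classic K}) [set k | forall y, lt y x -> f y <> k].
  rewrite /f Fix_eq // => {}x g h gh; rewrite /F.
  apply: (congr1 (xget (k0 : {classic K}))).
  by apply/predeqP => k /=; split => + y yx => /(_ y yx); rewrite gh.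
have fP x y : D x -> lt y x -> f y <> f x.
  move=> Dx; rewrite [f x]fE; case: xgetP => [k _|/= nk _]; first exact.
  exfalso; apply: (DK x Dx); have : forall k, exists y, lt y x /\ f y = k.
    move=> k; have /existsNP[z] := nk k => /not_implyP[zx /contrapT fz].
    by exists z.
  move=> /choice[g gP]; exists g; split=> [k k' gE|k]; last by case: (gP k).
  by rewrite -(gP k).2 gE (gP k').2.
exists (fun x => f (sval x)) => -[x Dx] [y Dy] /= fxy; apply: eq_exist.
by apply: contrapT => /lt_total[/(fP _ _ Dy)|/(fP _ _ Dx)]; rewrite fxy.
Qed.

(** Subsets with the same code are equipotent, by symmetry of the statement. *)
Lemma subset_code_exists : exists code : set X -> option X,
  forall A B : set X, code A = code B ->
  exists f : {x | A x} -> {x | B x}, injective f.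
Proof.
have codeE (A : set X) : exists o : option X,
    if o is Some x then embeds_below {x | A x} x /\
      (forall y, lt y x -> ~ embeds_below {x | A x} y)
    else forall x, ~ embeds_below {x | A x} x.
  have [/ex_min[x]|] := pselect ([set x | embeds_below {x | A x} x] !=set0).
    by exists (Some x).
  by move=> /forallNP nk; exists None.
have [code codeP] := choice codeE; exists code => A B AB.
have := codeP B; have := codeP A; rewrite -AB.
case: (code _) => [x|]; last first.
  move=> _ /(fun h => embeds_of_not_below (D := setT) (fun x _ => h x))[h hI].
  exists (fun x => h (exist _ (sval x) Logic.I)) => y z /hI/(congr1 sval)/=.
  exact: sval_inj.
move=> [[h [hI hx]] _] [_ /(embeds_of_not_below (D := [set y | lt y x]))[u uI]].
by exists (fun k => u (exist _ (h k) (hx k))) => y z /uI/(congr1 sval)/hI.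
Qed.

End cardinal_code.

Local Open Scope ring_scope.

(** * A topological generator of the torus *)

Lemma prefix_separation (zs : seq (nat -> bool)) :
  exists l, {in zs &, injective (fun z => mkseq z l)}.
Proof.
have LE (zz : (nat -> bool) * (nat -> bool)) : exists n, zz.1 n = zz.2 n -> zz.1 = zz.2.
  have [zE|/existsNP[n zn]] := pselect (forall n, zz.1 n = zz.2 n).
    by exists 0 => _; apply/funext.
  by exists n.
have [L LP] := choice LE.
exists (\max_(z <- zs) \max_(z' <- zs) (L (z, z')).+1)%N => z z' zin zin' zE.
apply: (LP (z, z')); set l := bigop _ _ _ in zE.
have ll : (L (z, z') < l)%N.
  pose F u := (\max_(z' <- zs) (L (u, z')).+1)%N.
  apply: leq_trans (leq_bigmax_seq (F := F) _ zin isT).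
  exact: (leq_bigmax_seq (F := fun z' => (L (z, z')).+1) _ zin' isT).
by have := congr1 (nth false ^~ (L (z, z'))) zE; rewrite !nth_mkseq.
Qed.

(** The real attached to [f : X] is the sum of the [digit f p / (p + 2)!], an
    expansion in the factorial number system. Multiplying it by [(p + 1)!]
    leaves, modulo 1, a number within [1 / (p + 2)] of [digit f p / (p + 2)].
    The digits of index [p] are computed from [p] and from finitely many bits of
    [f] so that every finite set of requirements is met at infinitely many
    [p]. *)
Section digits.
Variable R : realType.
Local Notation X := (nat -> bool).

(** A prescription [(l, ks, ws, V)] requires the value [w / (V + 1)] from the
    points whose first [l] bits form the word of [ks] at the index of [w] in
    [ws]. *)
Definition prescription : Type := (nat * seq (seq bool) * seq nat * nat)%type.
HB.instance Definition _ := Countable.on prescription.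

(** The numerator required by [d] at [f], reduced so as to be less than the
    denominator. It is 0 when no word of [ks] is a prefix of [f], provided that
    [ws] is not longer than [ks]. *)
Definition prescribed (d : prescription) (f : X) : nat :=
  let: (l, ks, ws, V) := d in (nth 0 ws (index (mkseq f l) ks) %% V.+1)%N.

(** The prescription obeyed by the digits of index [p]. The second component of
    the decoded pair is ignored, so that each prescription recurs infinitely
    often (lemma [stage_exists]). *)
Definition stage (p : nat) : prescription :=
  if (unpickle p : option (prescription * nat)) is Some (d, _) then d
  else (0, [::], [::], 0)%N.

(** The integral part of [p + 2] times the prescribed value. *)
Definition digit (f : X) (p : nat) : nat :=
  (p.+2 * prescribed (stage p) f %/ (stage p).2.+1)%N.

(** The partial sum of the first [p] terms, multiplied by [(p + 1)!]. *)
Fixpoint approx (f : X) (p : nat) : nat :=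
  if p is q.+1 then (q.+2 * approx f q + digit f q)%N else 0.

Lemma prescribed_le d f : (prescribed d f <= d.2)%N.
Proof. by case: d => [[[l ks] ws] V] /=; rewrite -ltnS ltn_mod. Qed.

Lemma digit_le f p : (digit f p <= p.+1)%N.
Proof.
rewrite /digit -ltnS ltn_divLR //.
by rewrite ltn_pmul2l // ltnS prescribed_le.
Qed.

Lemma stage_exists d m : exists2 p, (m <= p)%N & stage p = d.
Proof.
pose g (n : nat) := pickle (d, n).
have gI : injective g by move=> a b /(pcan_inj pickleK) [].
have [n /ltnW mn] := injective_gtn gI m.
by exists (g n) => //; rewrite /stage /g pickleK.
Qed.

Definition kronecker_real (f : X) : R :=
  sup [set (approx f p)%:R / (p.+1)`!%:R | p in [set: nat]].

Let fact_gt0R p : 0 < (p`!)%:R :> R. Proof. by rewrite ltr0n fact_gt0. Qed.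

(** The intervals enclosing the limit are nested. *)
Lemma approx_nested f p n :
  (approx f p)%:R / (p.+1)`!%:R <= (approx f (p + n))%:R / ((p + n).+1)`!%:R :> R /\
  ((approx f (p + n)).+1)%:R / ((p + n).+1)`!%:R
    <= ((approx f p).+1)%:R / (p.+1)`!%:R :> R.
Proof.
elim: n => [|n [IH1 IH2]]; first by rewrite addn0.
rewrite addnS; split.
  apply: le_trans IH1 _; rewrite ler_pdivrMr // mulrAC ler_pdivlMr //.
  by rewrite -!natrM ler_nat /= [(_.+2)`!]factS; nia.
apply: le_trans IH2; rewrite ler_pdivrMr // mulrAC ler_pdivlMr //.
rewrite -!natrM ler_nat /= [(_.+2)`!]factS.
have := digit_le f (p + n); set d := digit _ _; set a := approx _ _.
set F := _`! => dp; nia.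
Qed.

Lemma kronecker_real_itv f p :
  (approx f p)%:R / (p.+1)`!%:R <= kronecker_real f <= ((approx f p).+1)%:R / (p.+1)`!%:R.
Proof.
have ub q : ubound [set (approx f p)%:R / (p.+1)`!%:R | p in [set: nat]]
    (((approx f q).+1)%:R / (q.+1)`!%:R : R).
  move=> _ [r _ <-].
  have [qr|/ltnW rq] := leqP q r.
    have := (approx_nested f q (r - q)).2; rewrite subnKC // => h; apply: (le_trans _ h).
    by rewrite ler_pM2r ?invr_gt0 // ler_nat.
  have := (approx_nested f r (q - r)).1; rewrite subnKC // => h; apply: (le_trans h).
  by rewrite ler_pM2r ?invr_gt0 // ler_nat.
apply/andP; split.
  apply: ub_le_sup; last by exists p.
  by exists (((approx f 0).+1)%:R / (0.+1)`!%:R); exact: ub.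
by apply: ge_sup; [exists ((approx f 0)%:R / (0.+1)`!%:R); exists 0|exact: ub].
Qed.

Lemma kronecker_real_stage f p :
  `|kronecker_real f *+ (p.+1)`! - (approx f p)%:R
     - (prescribed (stage p) f)%:R / (stage p).2.+1%:R| <= p.+2%:R^-1.
Proof.
have /andP[] := kronecker_real_itv f p.+1.
rewrite ler_pdivrMr // ler_pdivlMr // [(p.+2)`!]factS.
move: (p.+1)`! => F; rewrite [approx f p.+1]/=.
set u := prescribed _ _; set V := _.2.+1; set a := approx f p.
set d := digit f p => lo up.
have dV : (d * V <= p.+2 * u)%N by exact: leq_divM.
have uV : (p.+2 * u < d.+1 * V)%N by exact: ltn_ceil.
have V0 : 0 < V%:R :> R by rewrite ltr0n.
have p0 : 0 < p.+2%:R :> R by rewrite ltr0n.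
have h1 : d%:R <= u%:R * p.+2%:R / V%:R :> R.
  by rewrite ler_pdivlMr // -!natrM ler_nat [(u * _)%N]mulnC.
have h2 : u%:R * p.+2%:R / V%:R <= d.+1%:R :> R.
  by rewrite ler_pdivrMr // -!natrM ler_nat [(u * _)%N]mulnC ltnW.
rewrite natrD !natrM in lo.
rewrite -[(_ + _).+1]addn1 !natrD !natrM in up.
rewrite -[d.+1]addn1 natrD in h2.
rewrite -mulr_natr ler_norml.
rewrite -[p.+2%:R^-1 : R]div1r -mulNr ler_pdivrMr // ler_pdivlMr //.
apply/andP; split; lra.
Qed.

(** Density of the multiples of [(kronecker_real f)_f] in the torus of reals
    modulo 1. *)
Lemma kronecker_density (zs : seq X) (theta : X -> R) (e : R) : 0 < e ->
  exists n : nat, {in zs, forall z, exists k : int,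
    `|kronecker_real z *+ n - theta z - k%:~R| < e}.
Proof.
move=> e0; have [l lI] := prefix_separation zs.
(* half of [e] is spent on rounding [theta] to a multiple of [1 / (m + 1)], and
   half on the error [1 / (p + 2)] at a stage [p >= m] *)
pose m := Num.bound (2 / e).
have me : m.+1%:R^-1 < e / 2.
  rewrite -[e / 2]invrK ltf_pV2 ?posrE ?invr_gt0 ?divr_gt0 // invf_div.
  apply: lt_trans (archi_boundP _) _; first by rewrite divr_ge0 // ltW.
  by rewrite ltr_nat.
pose w z := Num.truncn ((theta z - (Num.floor (theta z))%:~R) * m.+1%:R).
pose d : prescription := (l, [seq mkseq z l | z <- zs], [seq w z | z <- zs], m).
have [p mp pd] := stage_exists d m.
exists (p.+1)`! => z zin.
have fr0 : 0 <= theta z - (Num.floor (theta z))%:~R by rewrite subr_ge0 floor_le.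
have fr1 : theta z - (Num.floor (theta z))%:~R < 1.
  by rewrite ltrBlDl; have := floorD1_gt (theta z); rewrite intrD.
have fw : (w z)%:R <= (theta z - (Num.floor (theta z))%:~R) * m.+1%:R < (w z).+1%:R.
  by apply: truncn_itv; rewrite mulr_ge0.
have wm : (w z < m.+1)%N.
  rewrite -(ltr_nat R); have /andP[h _] := fw; apply: le_lt_trans h _.
  by rewrite gtr_pMl // ltr0n.
have uE : prescribed (stage p) z = w z.
  rewrite pd /prescribed /= (nth_map z) ?nth_index_map //.
    by rewrite modn_small.
  by rewrite -(size_map (fun z => mkseq z l)) index_mem; apply/mapP; exists z.
exists ((approx z p)%:Z - Num.floor (theta z)).
have := kronecker_real_stage z p; rewrite uE pd /=.
have pe : p.+2%:R^-1 < e / 2.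
  apply: le_lt_trans me; rewrite lef_pV2 ?posrE ?ltr0n // ler_nat.
  by rewrite ltnS ltnW.
have m0 : 0 < m.+1%:R :> R by rewrite ltr0n.
move: fw; rewrite -ler_pdivrMr // -ltr_pdivlMr //.
rewrite -[_.+1%:R in X in _ && X]natr1 mulrDl mul1r.
rewrite intrB -[(approx z p)%:~R]/((approx z p)%:R).
move=> /andP[f1 f2]; rewrite !ler_norml => /andP[g1 g2].
rewrite ltr_norml; move: (kronecker_real z *+ _) (p.+2%:R^-1) (m.+1%:R^-1) me pe
  g1 g2 f1 f2 => P a b.
by move=> *; apply/andP; split; lra.
Qed.

End digits.

Local Open Scope complex_scope.

(** * The metric of the circle *)

Section circle_metric.
Variable R : realType.
Implicit Types (v w : circle R) (r s : R).

(** The chordal distance of [w] to the neutral element; the distance between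
    [v] and [w] is [cdist (v - w)]. *)
Definition cdist w : R :=
  Num.sqrt ((complex.Re (val w) - 1) ^+ 2 + complex.Im (val w) ^+ 2).

Lemma cdistE w : `|val w - 1| = (cdist w)%:C.
Proof. by rewrite normc_def raddfB /= raddfB /= subr0. Qed.

Lemma cdist_ge0 w : 0 <= cdist w. Proof. exact: sqrtr_ge0. Qed.

Lemma cdist_eq0 w : cdist w = 0 -> w = 0.
Proof.
move=> w0; apply/val_inj/eqP; rewrite -subr_eq0 -normr_eq0 cdistE w0.
by [].
Qed.

Lemma cdist0 : cdist 0 = 0.
Proof. by apply/complexI; rewrite -cdistE /= subrr normr0. Qed.

Lemma cdistD v w : cdist (v + w) <= cdist v + cdist w.
Proof.
rewrite -lecR rmorphD /= -!cdistE /=.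
have -> : val v * val w - 1 = (val v - 1) * val w + (val w - 1) by ring.
by apply: le_trans (ler_normD _ _) _; rewrite normrM (eqP (valP w)) mulr1.
Qed.

Lemma cdistN w : cdist (- w) = cdist w.
Proof.
apply/complexI; rewrite -!cdistE /= distrC.
have w0 : val w != 0 by rewrite -normr_eq0 (eqP (valP w)) oner_eq0.
rewrite -[LHS]mulr1 -{2}(eqP (valP w)) -normrM mulrBl mul1r mulVf //.
Qed.

Lemma circle_norm w : complex.Re (val w) ^+ 2 + complex.Im (val w) ^+ 2 = 1.
Proof.
have /eqP/(congr1 (fun z : R[i] => z ^+ 2)) := valP w.
rewrite normc_def expr1n -rmorphXn /= sqr_sqrtr ?addr_ge0 ?sqr_ge0 //.
by move=> /complexI.
Qed.

(** Points at the same distance of the neutral element are conjugate. *)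
Lemma cdist_inj v w : cdist v = cdist w -> v = w \/ v = - w.
Proof.
move=> /(congr1 (fun r => r ^+ 2)); rewrite !sqr_sqrtr ?addr_ge0 ?sqr_ge0 //.
have := circle_norm v; have := circle_norm w; move=> nw nv d.
have re : complex.Re (val v) = complex.Re (val w) by nra.
have : (complex.Im (val v) - complex.Im (val w)) *
    (complex.Im (val v) + complex.Im (val w)) = 0 by nra.
move=> /eqP; rewrite mulf_eq0 => /orP[/eqP/subr0_eq im|/eqP im].
  by left; apply/val_inj/eqP; rewrite eq_complex re im !eqxx.
right; apply/eqP; rewrite -addr_eq0; apply/eqP/val_inj.
move: re im nw; rewrite /=; case: (val v) => a b; case: (val w) => c d' /= -> im nw.
by apply/eqP; rewrite eq_complex /=; apply/andP; split; apply/eqP; nra.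
Qed.

Lemma nbhs_circle w (U : set (circle R)) :
  nbhs w U <-> exists2 e, 0 < e & forall v, cdist (v - w) < e -> U v.
Proof.
have wn v : `|val v| = 1 by exact: (eqP (valP v)).
have dE v : `|val w - val v| = (cdist (v - w))%:C.
  have w0 : val w != 0 by rewrite -normr_eq0 wn oner_eq0.
  have wV : `|(val w)^-1| = 1 by rewrite normfV wn invr1.
  rewrite -cdistE distrC -[LHS]mulr1; rewrite -[X in _ * X]wV -normrM.
  by rewrite mulrBl divff.
split=> [|[e e0 eU]].
  rewrite (@nbhsE (initial_topology (fun z : circle R => val z : R[i]^o))).
  move=> [_ [[B Bo <-] /= Bw] BU].
  have /nbhs_ballP[e /= e0 eB] : nbhs (val w : R[i]^o) B by exact: open_nbhs_nbhs.
  have eE : e = (complex.Re e)%:C.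
    by rewrite RRe_real // realE ltW.
  exists (complex.Re e); first by rewrite -ltcR -eE.
  move=> v vw; apply: BU => /=; apply: eB.
  by rewrite -ball_normE /= dE eE ltcR.
have cv : continuous (fun z : circle R => val z : R[i]^o).
  exact: initial_continuous.
have : nbhs (val w : R[i]^o) (ball (val w : R[i]^o) e%:C).
  by apply: nbhsx_ballx; rewrite /= ltcR.
move=> /(cv w); rewrite nbhs_simpl; apply: (@filterS _ (nbhs w)) => v.
rewrite /= -ball_normE /= dE ltcR.
exact: eU.
Qed.

Fact cis_subproof r :
  `|(cos (2 * pi * r) +i* sin (2 * pi * r))%C : R[i]| == 1.
Proof. by rewrite normc_def /= cos2Dsin2 sqrtr1. Qed.

(** The one-parameter group [r |-> exp(2 i pi r)], of period 1. *)
Definition cis r : circle R := Circle (cis_subproof r).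

Lemma cisD r s : cis (r + s) = cis r + cis s.
Proof.
apply/val_inj/eqP; rewrite eq_complex /= mulrDr cosD sinD eqxx.
by apply/eqP; ring.
Qed.

Lemma cis0 : cis 0 = 0.
Proof. by apply/val_inj; rewrite /= mulr0 cos0 sin0. Qed.

Lemma cisN r : cis (- r) = - cis r.
Proof. by apply/eqP; rewrite -addr_eq0 -cisD addNr cis0. Qed.

Lemma cisMn r n : cis (r *+ n) = cis r *+ n.
Proof.
by elim: n => [|n IH]; rewrite ?mulr0n ?cis0 // !mulrS cisD IH.
Qed.

Lemma cisMz r (k : int) : cis (r *~ k) = cis r *~ k.
Proof.
case: k => n; first by rewrite -!pmulrn cisMn.
by rewrite NegzE !mulrNz cisN -!pmulrn cisMn.
Qed.

Lemma cis1 : cis 1 = 0.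
Proof.
by apply/val_inj; rewrite /= mulr1 mulr_natl cos2pi sin2pi.
Qed.

Lemma cis_int (k : int) : cis k%:~R = 0.
Proof. by rewrite cisMz cis1 mul0rz. Qed.

Lemma cdist_half : cdist (cis 2^-1) = 2.
Proof.
rewrite /cdist /= mulrAC divff ?pnatr_eq0 // mul1r cospi sinpi.
rewrite (_ : _ + _ = 2 ^+ 2); last by ring.
by rewrite sqrtr_sqr ger0_norm.
Qed.

Lemma cis_small e : 0 < e ->
  exists2 d, 0 < d & forall r, `|r| < d -> cdist (cis r) < e.
Proof.
move=> e0.
have c : {for 0, continuous (fun r => cdist (cis r))}.
  apply: (@continuous_comp _ _ _
    (fun r => (complex.Re (val (cis r)) - 1) ^+ 2 +
              complex.Im (val (cis r)) ^+ 2) (@Num.sqrt R));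
    last exact: sqrt_continuous.
  have c2 : {for 0, continuous (fun r : R => 2 * pi * r)}.
    by apply: mulrl_continuous.
  have cc : {for 0, continuous (fun r : R => cos (2 * pi * r))}.
    apply: (continuous_comp c2); exact: continuous_cos.
  have cs : {for 0, continuous (fun r : R => sin (2 * pi * r))}.
    apply: (continuous_comp c2); exact: continuous_sin.
  apply: cvgD; rewrite !expr2; apply: cvgM => //=; apply: cvgB => //; exact: cvg_cst.
move/cvgrPdist_lt: c => /(_ e e0) /nbhs_ballP[d /= d0 dP].
exists d => // r rd; have := dP r; rewrite /ball /= sub0r normrN => /(_ rd).
by rewrite cis0 cdist0 sub0r normrN ger0_norm // cdist_ge0.
Qed.

End circle_metric.

(** * Neighborhoods in subgroups of a torus *)

Section torus_topology.
Variables (R : realType) (I : eqType).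
Implicit Types (f g : {ptws I -> circle R}).

(** [g] is at distance less than [e] from [f] at each coordinate of [xs]. *)
Definition near_on (xs : seq I) (e : R) f g :=
  {in xs, forall x, cdist (g x - f x) < e}.

Lemma nbhs_ptws_circle f (U : set {ptws I -> circle R}) :
  nbhs f U <-> exists xs e, 0 < e /\ near_on xs e f `<=` U.
Proof.
split.
  pose F : set_system {ptws I -> circle R} :=
    [set V | exists xs e, 0 < e /\ near_on xs e f `<=` V].
  have FF : Filter F.
    split.
    - by exists [::], 1.
    - move=> A B [xs [e [e0 eA]]] [ys [e' [e'0 eB]]].
      exists (xs ++ ys), (Num.min e e'); split; first by rewrite lt_min e0.
      move=> g gn; split; [apply: eA|apply: eB] => x xin.
        by have := gn x; rewrite mem_cat xin lt_min => /(_ isT)/andP[].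
      by have := gn x; rewrite mem_cat xin orbT lt_min => /(_ isT)/andP[].
    - by move=> A B AB [xs [e [e0 eA]]]; exists xs, e; split => // g /eA/AB.
  suff : F --> f by apply.
  apply/cvg_sup => i; move=> V /=.
  rewrite (@nbhsE (initial_topology (fun f : I -> circle R => f i))).
  move=> [_ [[B Bo <-] /= Bf] BV].
  have /nbhs_circle[e e0 eB] : nbhs (f i) B by exact: open_nbhs_nbhs.
  exists [:: i], e; split => // g /(_ i (mem_head _ _)) gi.
  by apply: BV; exact: eB.
move=> [xs [e [e0 eU]]]; apply: filterS eU _.
elim: xs => [|x xs IH]; first by apply: (@filterS _ (nbhs f) _ setT) => [g _ x //|];
  exact: filterT.
have cx : {for f, continuous (fun g : {ptws I -> circle R} => g x)}.
  exact: (@proj_continuous I (fun=> circle R) x).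
have /cx : nbhs (f x) [set w | cdist (w - f x) < e].
  by apply/nbhs_circle; exists e.
rewrite nbhs_simpl => nx; apply: filterS2 IH nx => g gn gx y.
by rewrite inE => /orP[/eqP->|/gn].
Qed.

Variable G : zmodClosed {ptws I -> circle R}.

Lemma nbhs_subgroup (g : subgroup G) (U : set (subgroup G)) :
  nbhs g U <-> exists xs e, 0 < e /\
    forall h : subgroup G, near_on xs e (val g) (val h) -> U h.
Proof.
split.
  rewrite (@nbhsE (initial_topology (val : subgroup G -> {ptws I -> circle R}))).
  move=> [_ [[B Bo <-] /= Bg] BU].
  have /nbhs_ptws_circle[xs [e [e0 eB]]] : nbhs (val g) B by exact: open_nbhs_nbhs.
  by exists xs, e; split => // h gh; apply: BU; exact: eB.
move=> [xs [e [e0 eU]]].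
have cv : continuous (val : subgroup G -> {ptws I -> circle R}).
  exact: initial_continuous.
have /(cv g) : nbhs (val g) (near_on xs e (val g)).
  by apply/nbhs_ptws_circle; exists xs, e; split.
by rewrite nbhs_simpl; apply: (@filterS _ (nbhs g)) => h; exact: eU.
Qed.

Lemma val_subgroupB (g h : subgroup G) x : val (g - h) x = val g x - val h x.
Proof. by []. Qed.

Lemma val_subgroupD (g h : subgroup G) x : val (g + h) x = val g x + val h x.
Proof. by []. Qed.

Lemma val_subgroupMn (g : subgroup G) n x : val (g *+ n) x = val g x *+ n.
Proof. by elim: n => [|n IH]; rewrite ?mulr0n // !mulrS val_subgroupD IH. Qed.

End torus_topology.

(** * The group and its axes *)

(** A bijection between [X * X] and [X]: the bits of the two components are put
    at even and odd positions. *)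
Definition interleave (u : (nat -> bool) * (nat -> bool)) : nat -> bool :=
  fun n => if odd n then u.2 n./2 else u.1 n./2.

Definition deinterleave (f : nat -> bool) : (nat -> bool) * (nat -> bool) :=
  (fun n => f n.*2, fun n => f n.*2.+1).

Lemma interleaveK : cancel interleave deinterleave.
Proof.
case=> f g; rewrite /interleave /deinterleave; congr pair; apply/funext => n /=.
  by rewrite odd_double doubleK.
by rewrite odd_double /= uphalf_double.
Qed.

Lemma deinterleaveK : cancel deinterleave interleave.
Proof.
move=> f; apply/funext => n; rewrite /interleave /deinterleave /=.
by case: ifP => on; rewrite -[in RHS](odd_double_half n) on.
Qed.

(** The parameters are the set [J] indexing the generators and, for each [j] in
    [J], the set [I j] indexing the coordinates owned by [j]. *)
Section generators.
Variables (R : realType) (J : set (nat -> bool)).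
Variable I : (nat -> bool) -> set (nat -> bool).
Local Notation X := (nat -> bool).
Implicit Types (x j : X) (s : seq X) (c : X -> int).

(** A coordinate [x] is a pair [(j, i)], owned by [j]; it is admissible if [j]
    is in [J] and [i] in [I j]. *)
Definition owner x : X := (deinterleave x).1.
Definition admissible x := J (owner x) /\ I (owner x) (deinterleave x).2.

(** The generator attached to [j]: zero at the coordinates owned by [j] and at
    those that are not admissible; elsewhere, no two pairs made of a coordinate
    and an index use the same real. *)
Definition generator j : {ptws X -> circle R} := fun x =>
  if `[< admissible x >] && (owner x != j)
  then cis (kronecker_real R (interleave (x, j))) else 0.

(** The combination of the generators of index in [s] with coefficients [c]. *)
Definition combination s c : {ptws X -> circle R} :=
  \sum_(j <- s) generator j *~ c j.

Lemma ptws_sumE (s : seq X) (F : X -> {ptws X -> circle R}) x :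
  (\sum_(j <- s) F j) x = \sum_(j <- s) F j x.
Proof. by elim/big_rec2: _ => // j _ f _ <-. Qed.

Lemma ptws_mulnE (f : {ptws X -> circle R}) n x : (f *+ n) x = f x *+ n.
Proof. by elim: n => [|n IH]; rewrite ?mulr0n // !mulrS -IH. Qed.

Lemma ptws_mulzE (f : {ptws X -> circle R}) k x : (f *~ k) x = f x *~ k.
Proof.
case: k => n; first by rewrite -!pmulrn ptws_mulnE.
by rewrite NegzE !mulrNz -!pmulrn -ptws_mulnE.
Qed.

Lemma cis_sum (T : Type) (r : seq T) (P : pred T) (F : T -> R) :
  cis (\sum_(i <- r | P i) F i) = \sum_(i <- r | P i) cis (F i).
Proof. by elim/big_rec2: _ => [|i _ u _ <-]; rewrite ?cis0 ?cisD. Qed.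

Lemma combE s c x : admissible x -> combination s c x =
  cis (\sum_(j <- s | owner x != j) kronecker_real R (interleave (x, j)) *~ c j).
Proof.
move=> vx; rewrite /combination ptws_sumE cis_sum [RHS]big_mkcond /=.
apply: eq_bigr => j _; rewrite ptws_mulzE /generator asboolT //=.
by case: ifP => _; rewrite ?mul0rz ?cisMz.
Qed.

Lemma comb_invalid s c x : ~ admissible x -> combination s c x = 0.
Proof.
move=> vx; rewrite /combination ptws_sumE big1 // => j _.
by rewrite ptws_mulzE /generator asboolF //= mul0rz.
Qed.

Lemma kronecker_comb s c (xs : seq X) (theta : X -> R) (e : R) :
  uniq s -> {in xs, forall x, admissible x} ->
  {in xs, forall x, exists j, [/\ j \in s, owner x != j & c j != 0]} -> 0 < e ->
  exists n, {in xs, forall x, cdist (combination s c x *+ n - cis (theta x)) < e}.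
Proof.
move=> us vxs jxs e0.
(* At each [x] one index [piv x] is made responsible for the whole target
   [theta x]; the reals of the other indices are driven close to integers. *)
have [piv pivP] : exists piv : X -> X, {in xs, forall x,
    [/\ piv x \in s, owner x != piv x & c (piv x) != 0]}.
  have pivE x : exists j, x \in xs -> [/\ j \in s, owner x != j & c j != 0].
    by have [/jxs[j]|] := boolP (x \in xs); exists j || exists x.
  have [piv pivP] := choice pivE; by exists piv => x /pivP.
have [d d0 dP] := cis_small e0.
(* [M] bounds the amplification of the errors by the coefficients *)
pose M : R := 1 + \sum_(j <- s) `|(c j)%:~R|.
have M0 : 0 < M by rewrite ltr_pwDl // sumr_ge0.
pose T z : R := let: (x, j) := deinterleave z in
  if j == piv x then theta x / (c j)%:~R else 0.
have [n nP] := kronecker_density [seq interleave (x, j) | x <- xs, j <- s] T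
  (divr_gt0 d0 M0).
exists n => x xin; have vx := vxs _ xin; have [ps po pc] := pivP _ xin.
have [k kP] : exists k : X -> int, {in s, forall j,
   `|kronecker_real R (interleave (x, j)) *+ n - T (interleave (x, j))
     - (k j)%:~R| < d / M}.
  have kE j : exists k : int, j \in s ->
    `|kronecker_real R (interleave (x, j)) *+ n - T (interleave (x, j)) - k%:~R| < d / M.
    have [js|] := boolP (j \in s); last by exists 0.
    have [|k kP] := nP (interleave (x, j)); last by exists k.
    by apply/allpairsP; exists (x, j).
  by have [k kP] := choice kE; exists k => j /kP.
rewrite combE // -cisMn -cisN -cisD.
pose K : int := \sum_(j <- s | owner x != j) k j * c j.
rewrite -[cis _]subr0 -(cis_int R K) -cisN -cisD; apply: dP.
have -> : theta x = \sum_(j <- s | owner x != j) T (interleave (x, j)) *~ c j.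
  rewrite big_mkcond (bigD1_seq (piv x)) //= po big1_seq ?addr0.
    by rewrite /T interleaveK eqxx -mulrzr divfK // intr_eq0.
  move=> j /andP[jp _]; case: ifP => // _.
  by rewrite /T interleaveK (negPf jp) mul0rz.
rewrite -sumrMnl /K rmorph_sum -!sumrB /=.
apply: le_lt_trans (ler_norm_sum _ _ _) _.
apply: (@le_lt_trans _ _ (\sum_(j <- s) `|(c j)%:~R| * (d / M))).
  rewrite big_mkcond /=; rewrite big_seq [leRHS]big_seq; apply: ler_sum => j js.
  case: ifP => _; last by rewrite mulr_ge0 // ltW // divr_gt0.
  rewrite intrM -mulrzr -[X in `|_ - X - _|]mulrzr -mulrnAl -!mulrBl normrM mulrC.
  by rewrite ler_wpM2l // ltW // kP.
rewrite -mulr_suml mulrA ltr_pdivrMr // mulrC ltr_pM2l //.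
by rewrite /M ltrDr.
Qed.

Lemma comb_neq0 s c x j : uniq s -> admissible x -> j \in s -> owner x != j ->
  c j != 0 -> combination s c x != 0.
Proof.
move=> us vx js xj cj; have [|||n nP] := @kronecker_comb s c [:: x] (fun=> 2^-1) 1 us.
- by move=> z; rewrite inE => /eqP->.
- by move=> z; rewrite inE => /eqP->; exists j.
- by [].
apply/eqP => c0; have := nP x (mem_head _ _).
by rewrite c0 mul0rn sub0r cdistN cdist_half ltrn1.
Qed.

End generators.

Section span_group.
Variables (R : realType) (J : set (nat -> bool)).
Variable I : (nat -> bool) -> set (nat -> bool).
Local Notation X := (nat -> bool).
Local Notation comb := (combination R J I).
Local Notation gen := (generator R J I).
Local Notation valid := (admissible J I).

(** The subgroup generated by the generators of index in [J]. *)
Definition gspan_pred : {pred {ptws X -> circle R}} := [pred g | `[< exists s c,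
  [/\ uniq s, {in s, forall j, J j} & g = comb s c] >]].

Lemma comb_widen (s t : seq X) c : uniq s -> uniq t -> {subset s <= t} ->
  comb s c = comb t (fun j => if j \in s then c j else 0).
Proof.
move=> us ut st; rewrite /comb.
under [RHS]eq_bigr do rewrite (fun_if (fun k => _ *~ k)) mulr0z.
rewrite -big_mkcond /= -[RHS]big_filter; apply: perm_big.
apply: uniq_perm => //; first exact: filter_uniq.
by move=> j; rewrite mem_filter; case: (boolP (j \in s)) => // /st ->.
Qed.

Lemma combB s c c' : comb s c - comb s c' = comb s (fun j => c j - c' j).
Proof. by rewrite /comb -sumrB; apply: eq_bigr => j _; rewrite mulrzBr. Qed.

Fact gspan_zmod_closed : zmod_closed gspan_pred.
Proof.
split=> [|f g].
  by apply/asboolP; exists [::], (fun=> 0); split => //; rewrite /comb big_nil.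
move=> /asboolP[s [c [us sJ ->]]] /asboolP[t [d [ut tJ ->]]]; apply/asboolP.
pose r := undup (s ++ t); have ur : uniq r by exact: undup_uniq.
exists r; eexists; split => //.
  by move=> j; rewrite mem_undup mem_cat => /orP[/sJ|/tJ].
rewrite (@comb_widen s r c us ur) ?(@comb_widen t r d ut ur) ?combB //.
  by move=> j jt; rewrite mem_undup mem_cat jt orbT.
by move=> j jt; rewrite mem_undup mem_cat jt.
Qed.

HB.instance Definition _ :=
  GRing.isZmodClosed.Build {ptws X -> circle R} gspan_pred gspan_zmod_closed.

Definition gspan : zmodClosed {ptws X -> circle R} := gspan_pred.

Local Notation G := (subgroup gspan).

Lemma gspan_combP (g : G) : exists s c,
  [/\ uniq s, {in s, forall j, J j} & val g = comb s c].
Proof. exact/asboolP/(valP g). Qed.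

Lemma generator_gspan j : J j -> gen j \in gspan.
Proof.
move=> Jj; apply/asboolP; exists [:: j], (fun=> 1); split => //.
  by move=> i; rewrite inE => /eqP->.
by rewrite /comb big_seq1.
Qed.

(** The axis of [j]: the elements vanishing at the coordinates owned by [j],
    i.e., the multiples of the generator of [j] (lemma [axis_multiple]). *)
Definition axis_pred (j : X) : {pred G} :=
  [pred g | `[< forall x, valid x -> owner x = j -> val g x = 0 >]].

Fact axis_zmod_closed j : zmod_closed (axis_pred j).
Proof.
split=> [|f g]; first by apply/asboolP.
move=> /asboolP f0 /asboolP g0; apply/asboolP => x vx xj.
by rewrite val_subgroupB f0 // g0 // subr0.
Qed.

HB.instance Definition _ j :=
  GRing.isZmodClosed.Build G (axis_pred j) (axis_zmod_closed j).

Definition axis (j : X) : zmodClosed G := axis_pred j.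

Lemma axisP j (g : G) :
  g \in axis j <-> (forall x, valid x -> owner x = j -> val g x = 0).
Proof. by split=> [/asboolP|h]; [|apply/asboolP]. Qed.

Lemma invalid0 (g : G) x : ~ valid x -> val g x = 0.
Proof. by have [s [c [_ _ ->]]] := gspan_combP g; exact: comb_invalid. Qed.

Lemma zero_coef s c x j : uniq s -> valid x -> comb s c x = 0 -> j \in s ->
  owner x != j -> c j = 0.
Proof.
move=> us vx c0 js xj; apply/eqP; apply: contraPT c0 => cj.
exact/eqP/(comb_neq0 R us vx js xj).
Qed.

Lemma val_cis (g : G) x : exists r, val g x = cis r.
Proof.
have [s [c [_ _ ->]]] := gspan_combP g.
have [vx|vx] := pselect (valid x); last first.
  by rewrite comb_invalid //; exists 0; rewrite cis0.
by rewrite combE //; eexists.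
Qed.

(** Multiples of [g] approximate any values at finitely many coordinates where
    [g] does not vanish. *)
Lemma kronecker_gspan (g : G) (xs : seq X) (theta : X -> R) (e : R) : 0 < e ->
  {in xs, forall x, val g x != 0} ->
  exists n, {in xs, forall x, cdist (val g x *+ n - cis (theta x)) < e}.
Proof.
move=> e0 gx; have [s [c [us sJ gE]]] := gspan_combP g.
have vx x : x \in xs -> valid x.
  by move=> /gx; apply: contraNP => /invalid0 ->.
rewrite gE; apply: kronecker_comb => //.
move=> x xin; apply: contrapT => /forallNP nj.
move: (gx _ xin); rewrite gE combE; last exact: vx.
rewrite big_seq_cond big1 ?cis0 ?eqxx //.
move=> j /andP[js xj]; apply/eqP; apply: contraPT (nj j) => cj.
rewrite not_notE; split => //; apply: contraNneq cj => ->.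
by rewrite mulr0z.
Qed.

(** Consequently, [h] is in the closure of the multiples of [g] if it vanishes
    wherever [g] does. *)
Lemma kronecker_approx (g h : G) (xs : seq X) (e : R) : 0 < e ->
  {in xs, forall x, val g x = 0 -> val h x = 0} ->
  exists n, near_on xs e (val h) (val (g *+ n)).
Proof.
move=> e0 gh; have [t tP] := choice (val_cis h).
have [|n nP] := @kronecker_gspan g [seq x <- xs | val g x != 0] t e e0.
  by move=> x; rewrite mem_filter => /andP[].
exists n => x xin; rewrite val_subgroupMn.
have [g0|g0] := eqVneq (val g x) 0.
  by rewrite g0 mul0rn sub0r gh // oppr0 cdist0.
by rewrite tP; apply: nP; rewrite mem_filter g0.
Qed.

(** Vanishing at an admissible coordinate depends only on its owner. *)
Lemma vanish_owner (g : G) x x' : valid x -> valid x' -> owner x = owner x' ->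
  val g x = 0 -> val g x' = 0.
Proof.
have [s [c [us sJ ->]]] := gspan_combP g => vx vx' xx' g0.
rewrite combE // big_seq_cond big1 ?cis0 // => j /andP[js xj].
by rewrite (zero_coef us vx g0 js) ?mulr0z // xx'.
Qed.

Hypothesis I0 : forall j, J j -> I j !=set0.

Lemma valid_ex j : J j -> exists2 x, valid x & owner x = j.
Proof.
move=> Jj; have [i Ii] := I0 Jj; exists (interleave (j, i)).
  by rewrite /valid /owner interleaveK.
by rewrite /owner interleaveK.
Qed.

Lemma axis_multiple j (g : G) : J j -> g \in axis j ->
  exists k, val g = gen j *~ k.
Proof.
move=> Jj /axisP gj; have [x vx xj] := valid_ex Jj; have := gj x vx xj.
have [s [c [us sJ ->]]] := gspan_combP g => c0.
have cj i : i \in s -> i != j -> c i = 0.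
  by move=> si ij; apply: (zero_coef us vx c0 si); rewrite xj eq_sym.
rewrite /comb; have [js|js] := boolP (j \in s).
  exists (c j); rewrite (bigD1_seq j) //= big1_seq ?addr0 // => i /andP[ij si].
  by rewrite cj // mulr0z.
exists 0; rewrite mulr0z big1_seq // => i /andP[_ si]; rewrite cj ?mulr0z //.
by apply: contraNneq js => <-.
Qed.

Lemma generator_neq0 j x : J j -> valid x -> owner x != j -> gen j x != 0.
Proof.
move=> Jj vx xj; have := @comb_neq0 R J I [:: j] (fun=> 1) x j isT vx (mem_head _ _) xj.
by rewrite /comb big_seq1; apply.
Qed.

Lemma generator_own0 j x : owner x = j -> gen j x = 0.
Proof. by move=> xj; rewrite /gen xj eqxx andbF. Qed.

Lemma sum_axes_nonvanishing j j' (g h : G) x : J j -> J j' -> j != j' ->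
  g \in axis j -> h \in axis j' -> g != 0 -> h != 0 -> valid x ->
  val (g + h) x != 0.
Proof.
move=> Jj Jj' jj' /(axis_multiple Jj)[k gE] /(axis_multiple Jj')[l hE] g0 h0 vx.
have k0 : k != 0.
  by apply: contraNneq g0 => k0; apply/eqP/val_inj; rewrite gE k0 mulr0z.
have l0 : l != 0.
  by apply: contraNneq h0 => l0; apply/eqP/val_inj; rewrite hE l0 mulr0z.
have -> : val (g + h) = comb [:: j; j'] (fun i => if i == j then k else l).
  by rewrite /comb big_cons big_seq1 eqxx eq_sym (negPf jj') -gE -hE.
have u2 : uniq [:: j; j'] by rewrite /= inE jj'.
have [xj|xj] := eqVneq (owner x) j.
  apply: (@comb_neq0 _ _ _ _ _ _ j') => //; rewrite ?inE ?eqxx ?orbT ?xj //.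
  by rewrite ifN // eq_sym.
by apply: (@comb_neq0 _ _ _ _ _ _ j) => //; rewrite ?inE ?eqxx.
Qed.

End span_group.

Arguments gspan : clear implicits.

(** * Zero-dimensionality and monotheticity *)

Section near_on_topology.
Variables (R : realType) (I : eqType) (G : zmodClosed {ptws I -> circle R}).
Implicit Types g h : subgroup G.

Lemma cdist_tri (u v w : circle R) :
  cdist (u - w) <= cdist (u - v) + cdist (v - w).
Proof. by have := cdistD (u - v) (v - w); rewrite addrA subrK. Qed.

Lemma nbhs_close g h x e : cdist (val h x - val g x) < e ->
  nbhs h [set h' : subgroup G | cdist (val h' x - val g x) < e].
Proof.
move=> hg; apply/nbhs_subgroup; exists [:: x], (e - cdist (val h x - val g x)).
split=> [|h' /(_ x (mem_head _ _))]; first by rewrite subr_gt0.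
by rewrite ltrBrDr => h'h; apply: le_lt_trans h'h; exact: cdist_tri.
Qed.

Lemma nbhs_far g h x e : e < cdist (val h x - val g x) ->
  nbhs h [set h' : subgroup G | e < cdist (val h' x - val g x)].
Proof.
move=> hg; apply/nbhs_subgroup; exists [:: x], (cdist (val h x - val g x) - e).
split=> [|h' /(_ x (mem_head _ _))]; first by rewrite subr_gt0.
rewrite ltrBrDr /= -ltrBrDl => h'h; apply: lt_le_trans h'h _.
by rewrite lerBlDl -[cdist (val h' x - val h x)]cdistN opprB; exact: cdist_tri.
Qed.

Lemma open_near_on g xs e :
  open [set h : subgroup G | near_on xs e (val g) (val h)].
Proof.
rewrite openE => h; rewrite /interior /=.
elim: xs => [_|x xs IH gh]; first by apply: filterS filterT => h' _ y.
have {IH} := IH (fun y yxs => gh y (mem_behead (s := x :: xs) yxs)).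
have := @nbhs_close g h x e (gh x (mem_head _ _)).
apply: filterS2 => h' hx hxs y; rewrite inE => /orP[/eqP->//|].
exact: hxs.
Qed.

(** The condition excludes the boundary of the discs. *)
Lemma closed_near_on g xs e :
  (forall h x, x \in xs -> cdist (val h x - val g x) != e) ->
  closed [set h : subgroup G | near_on xs e (val g) (val h)].
Proof.
move=> ne; rewrite -openC openE => h /= nh; rewrite /interior.
have [x /not_implyP[xin /negP]] := (existsNP _).2 nh.
rewrite -leNgt le_eqVlt eq_sym (negPf (ne _ _ xin)) /= => /nbhs_far.
apply: filterS => h' /= far near; have := near x xin.
by rewrite ltNge ltW.
Qed.

End near_on_topology.

Section topology_of_the_span.
Variables (R : realType) (J : set (nat -> bool)).
Variable I : (nat -> bool) -> set (nat -> bool).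
Hypothesis J2 : exists j j', [/\ J j, J j' & j != j'].
Hypothesis I0 : forall j, J j -> I j !=set0.
Local Notation X := (nat -> bool).
Local Notation comb := (combination R J I).
Local Notation gen := (generator R J I).
Local Notation valid := (admissible J I).
Local Notation G := (subgroup (@gspan R J I)).
Local Notation axis := (axis R J I).

(** A multiple of [g] has proportional coefficients, so that it vanishes at [x]
    only if [g] does. *)
Lemma torsion_free (g : G) x n : val g x *+ n.+1 = 0 -> val g x = 0.
Proof.
have [vx|/invalid0->//] := pselect (valid x).
have [s [c [us sJ ->]]] := gspan_combP g.
have -> : comb s c x *+ n.+1 = comb s (fun j => c j * n.+1%:Z) x.
  rewrite -ptws_mulnE; congr (_ x); rewrite /combination -sumrMnl.
  by apply: eq_bigr => j _; rewrite pmulrn mulrzA.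
move=> c0; rewrite combE // big_seq_cond big1 ?cis0 // => j /andP[js xj].
have /eqP := zero_coef us vx c0 js xj; rewrite mulf_eq0 orbF => /eqP ->.
by rewrite mulr0z.
Qed.

Lemma another_index j : exists2 j', J j' & j' != j.
Proof.
have [a [b [Ja Jb ab]]] := J2; have [aj|] := eqVneq a j; last by exists a.
by exists b => //; rewrite -aj eq_sym.
Qed.

(** The basic neighborhoods are cut out by discs of radius [cdist w], with [w] a
    torsion point: a value of an element of the group on the boundary would be
    [w] or [- w] up to translation, hence a nonzero torsion point. *)
Lemma gspan_clopen_basis : has_clopen_basis G.
Proof.
exists clopen => //; split=> [U []//|g U].
move=> /nbhs_subgroup[xs [e [e0 eU]]].
have [d d0 dP] := cis_small e0.
pose n := Num.bound (d^-1).
have nd : (2 ^ n.+1)%:R^-1 < d.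
  rewrite -[d]invrK ltf_pV2 ?posrE ?invr_gt0 ?ltr0n ?expn_gt0 //.
  apply: lt_trans (archi_boundP _) _; first by rewrite invr_ge0 ltW.
  by rewrite ltr_nat; apply: (@ltn_trans (2 ^ n)%N); [exact: ltn_expl|rewrite ltn_exp2l].
pose w : circle R := cis (2 ^ n.+1)%:R^-1.
have w0 : w *+ 2 ^ n.+1 = 0.
  by rewrite -cisMn -[_ *+ _]mulr_natr mulVf ?cis1 // pnatr_eq0 expn_eq0.
have wn0 : w != 0.
  apply/eqP => w0'; have := cdist_half R.
  have -> : cis 2^-1 = w *+ 2 ^ n :> circle R.
    by rewrite -cisMn; congr cis; rewrite expnS natrM -[RHS]mulr_natr invfM divfK //.
  by rewrite w0' mul0rn cdist0 => /eqP; rewrite eq_sym pnatr_eq0.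
exists [set h : G | near_on xs (cdist w) (val g) (val h)]; last first.
  move=> h /= hn; apply: eU => x xin; apply: lt_trans (hn x xin) _.
  by apply: dP; rewrite ger0_norm // invr_ge0.
have wpos : 0 < cdist w.
  by rewrite lt_neqAle cdist_ge0 andbT eq_sym; apply: contra_neq wn0 => /cdist_eq0.
split; last by move=> x xin; rewrite subrr cdist0.
split; first exact: open_near_on.
apply: closed_near_on => h x xin; apply/eqP => /cdist_inj hw.
have hg0 : val (h - g) x *+ (2 ^ n.+1).-1.+1 = 0.
  rewrite prednK ?expn_gt0 // val_subgroupB.
  by case: hw => ->; rewrite ?mulNrn w0 ?oppr0.
have := torsion_free hg0; rewrite val_subgroupB => hg.
move: hw; rewrite hg => -[/esym /eqP|/eqP].
  by rewrite (negPf wn0).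
by rewrite eq_sym oppr_eq0 (negPf wn0).
Qed.

(** The generators as elements of the group. *)
Lemma generator_lift : exists E : X -> G, forall j, J j -> val (E j) = gen j.
Proof.
have EE j : exists g : G, J j -> val g = gen j.
  have [Jj|nJ] := pselect (J j); last by exists 0.
  by exists (exist _ (gen j) (generator_gspan R I Jj)).
by have [E EP] := choice EE; exists E.
Qed.

Lemma generator_in_axis (g : G) j : val g = gen j -> g \in axis j.
Proof. by move=> gE; apply/axisP => x _ xj; rewrite gE generator_own0. Qed.

Lemma generator_nonzero (g : G) j : J j -> val g = gen j -> g != 0.
Proof.
move=> Jj gE; have [j' Jj' jj'] := another_index j.
have [x vx xj] := valid_ex I0 Jj'.
have := generator_neq0 R Jj vx; rewrite xj -gE => /(_ jj').
by apply: contra_neq => ->.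
Qed.

(** The sum of two generators vanishes at no admissible coordinate. *)
Lemma nonvanishing_element : exists g : G, forall x, valid x -> val g x != 0.
Proof.
have [a [b [Ja Jb ab]]] := J2; have [E EP] := generator_lift.
exists (E a + E b) => x vx; apply: (sum_axes_nonvanishing I0 Ja Jb) => //.
- exact/generator_in_axis/EP.
- exact/generator_in_axis/EP.
- exact/(generator_nonzero Ja)/EP.
- exact/(generator_nonzero Jb)/EP.
Qed.

Lemma gspan_monothetic : monothetic G.
Proof.
have [g gP] := nonvanishing_element; exists g => U [h Uh] oU.
have /nbhs_subgroup[xs [e [e0 eU]]] : nbhs h U by exact: open_nbhs_nbhs.
have [n nP] : exists n, near_on xs e (val h) (val (g *+ n)).
  apply: kronecker_approx => // x xin.
  have [/gP/eqP gx gx0|vx _] := pselect (valid x); first by case: gx.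
  exact: invalid0.
by exists (g *+ n); split; [exact: eU|exists n%:Z].
Qed.

End topology_of_the_span.

(** * Freeness and closed subgroups *)

Section closed_subgroups.
Variables (R : realType) (J : set (nat -> bool)).
Variable I : (nat -> bool) -> set (nat -> bool).
Hypothesis J2 : exists j j', [/\ J j, J j' & j != j'].
Hypothesis I0 : forall j, J j -> I j !=set0.
Local Notation X := (nat -> bool).
Local Notation comb := (combination R J I).
Local Notation gen := (generator R J I).
Local Notation valid := (admissible J I).
Local Notation G := (subgroup (@gspan R J I)).
Local Notation axis := (axis R J I).

Lemma val_sum (T : Type) (r : seq T) (F : T -> G) :
  val (\sum_(i <- r) F i) = \sum_(i <- r) val (F i).
Proof. by elim/big_rec2: _ => // i u v _ <-. Qed.

Lemma val_mulz (g : G) k : val (g *~ k) = val g *~ k.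
Proof.
have vn (h : G) n : val (h *+ n) = val h *+ n.
  by elim: n => // n IH; rewrite !mulrS -IH.
by case: k => n; rewrite ?NegzE ?mulrNz -!pmulrn -?vn.
Qed.

Lemma generator_inj j j' : J j -> J j' -> gen j = gen j' -> j = j'.
Proof.
move=> Jj Jj' jj'; apply/eqP; apply: contraT => nj.
have [x vx xj] := valid_ex I0 Jj.
have := generator_neq0 R Jj' vx; rewrite xj -jj' generator_own0 // => /(_ nj).
by rewrite eqxx.
Qed.

(** A vanishing combination is tested at a coordinate not owned by the index
    whose coefficient is to be shown to be zero. *)
Lemma gspan_free : free_abelian G.
Proof.
have [E EP] := @generator_lift R J I.
have [D DP] : exists D : G -> X, forall j, J j -> D (E j) = j.
  have DE g : exists j, forall j', J j' -> g = E j' -> j' = j.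
    have [[j [Jj gE]]|/forallNP nj] := pselect (exists j, J j /\ g = E j).
      exists j => j' Jj' gE'; apply: generator_inj => //.
      by rewrite -EP // -EP // -gE -gE'.
    by exists point => j' Jj' gE; case: (nj j').
  have [D DP] := choice DE; exists D => j Jj; apply/esym.
  exact: (DP (E j) j Jj erefl).
exists [set E j | j in J]; split.
  move=> g; have [s [c [us sJ gE]]] := gspan_combP g.
  exists (map E s), (c \o D); split.
    by move=> _ /mapP[j /sJ Jj ->]; exists j.
  apply/val_inj; rewrite gE val_sum big_map; apply: eq_big_seq => j /sJ Jj.
  by rewrite val_mulz /= DP // EP.
move=> s c us sB s0 b bs.
have sD : {in s, forall g, J (D g) /\ g = E (D g)}.
  by move=> g /sB[j Jj <-]; rewrite DP.
pose t := map D s.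
have ut : uniq t.
  rewrite map_inj_in_uniq // => g h /sD[_ gE] /sD[_ hE] gh.
  by rewrite gE hE gh.
have tc : comb t (c \o E) = 0.
  rewrite -[RHS](congr1 val s0) val_sum /combination big_map.
  apply: eq_big_seq => g /sD[Jg gE]; rewrite val_mulz /= -gE; congr (_ *~ _).
  by rewrite [in RHS]gE EP.
have [Jb bE] := sD _ bs; have [j' Jj' jb] := another_index J2 (D b).
have [x vx xj] := valid_ex I0 Jj'.
have := zero_coef (R := R) ut vx (c := c \o E) (j := D b).
by rewrite tc xj /= -bE; apply=> //; apply: map_f.
Qed.

Lemma closed_absorb (N : zmodClosed G) (g h : G) : closed [set` N] -> g \in N ->
  (forall x, val g x = 0 -> val h x = 0) -> h \in N.
Proof.
move=> cN gN gh; apply: cN => U /nbhs_subgroup[xs [e [e0 eU]]].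
have [n nP] := kronecker_approx (xs := xs) e0 (fun x _ => gh x).
by exists (g *+ n); split; [exact: rpredMn|exact: eU].
Qed.

(** If some element of [N] vanishes at no admissible coordinate, its multiples
    are dense. Otherwise every element of [N] lies on an axis, and two nonzero
    elements of [N] lie on the same axis, as their sum would else vanish
    nowhere. *)
Lemma closed_subgroupP (N : zmodClosed G) : proper_kernel N ->
  [set` N] = setT \/ exists2 j, J j & [set` N] = [set` axis j].
Proof.
move=> [cN [g gN g0]].
have [[f [fN fP]]|/forallNP nf] :=
    pselect (exists f : G, f \in N /\ forall x, valid x -> val f x != 0).
  left; apply/seteqP; split => // h _; apply: (closed_absorb cN fN) => x fx.
  by apply: invalid0 => /fP; rewrite fx eqxx.
right.
have onaxis (f : G) : f \in N -> exists2 j, J j & f \in axis j.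
  move=> fN; have := nf f; apply: contra_notP => nax; split => // x vx.
  apply/eqP => fx; apply: nax; exists (owner x); first by case: vx.
  apply/axisP => x' vx' xx'; exact: vanish_owner vx vx' (esym xx') fx.
have [j Jj gj] := onaxis _ gN; exists j => //; apply/seteqP; split=> h /= hN.
  have [j' Jj' hj'] := onaxis _ hN; have [->|h0] := eqVneq h 0; first exact: rpred0.
  have [->//|jj'] := eqVneq j j'.
  case: (nf (g + h)); split; first exact: rpredD.
  by move=> x vx; apply: (sum_axes_nonvanishing I0 Jj Jj').
apply: (closed_absorb cN gN) => x gx.
have [vx|/invalid0->//] := pselect (valid x).
have [xj|xj] := eqVneq (owner x) j; first exact: (axisP _ _).1 hN _ vx xj.
exfalso; have gx' : g \in axis (owner x).
  apply/axisP => x' vx' xx'; exact: vanish_owner vx vx' (esym xx') gx.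
have := sum_axes_nonvanishing I0 (proj1 vx) Jj xj gx' gj g0 g0 vx.
by rewrite val_subgroupD gx addr0 eqxx.
Qed.

Lemma axis_proper j : J j -> proper_kernel (axis j).
Proof.
move=> Jj; split; last first.
  have [E EP] := @generator_lift R J I; exists (E j).
    exact/generator_in_axis/EP.
  exact/(generator_nonzero J2 I0 Jj)/EP.
rewrite -openC openE => h /= /negP.
rewrite /interior => nh.
have [x [vx xj /eqP hx]] : exists x, [/\ valid x, owner x = j & val h x <> 0].
  apply: contrapT => /forallNP hn; move/negP: nh; apply; apply/axisP => x vx xj.
  by apply: contrapT => hx; apply: (hn x).
have hx0 : 0 < cdist (val h x - val (0 : G) x).
  rewrite subr0 lt_neqAle cdist_ge0 andbT eq_sym.
  by apply: contra_neq hx => /cdist_eq0.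
have := nbhs_far hx0; apply: filterS => h' /= h'x /axisP /(_ x vx xj) h'0.
by move: h'x; rewrite h'0 subr0 cdist0 ltxx.
Qed.

Lemma axis_inj j j' : J j -> J j' -> [set` axis j] = [set` axis j'] -> j = j'.
Proof.
move=> Jj Jj' jj'; have [E EP] := @generator_lift R J I.
have Ej : [set` axis j'] (E j) by rewrite -jj'; exact/generator_in_axis/EP.
have [x vx xj] := valid_ex I0 Jj'; move/axisP: Ej => /(_ x vx xj).
rewrite EP // => gx; apply/eqP; apply: contraT => nj.
have := generator_neq0 R Jj vx; rewrite xj eq_sym => /(_ nj).
by rewrite gx eqxx.
Qed.

End closed_subgroups.

(** * Weights of the quotients *)

Section quotient_projection.
Variables (V : topologicalZmodType) (N : zmodClosed V).

(** The canonical projection, as a map to the topological quotient. *)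
Definition quot_pi (x : V) : quotient_group N := (\pi_(Quotient.quot N) x)%qT.

Lemma quot_piP x y : quot_pi x = quot_pi y <-> x - y \in N.
Proof. by rewrite (Quotient.idealrBE N x y); split=> [xy|/eqP//]; apply/eqP. Qed.

Lemma quot_pi_surj (q : quotient_group N) : exists x, quot_pi x = q.
Proof. by exists (repr (q : Quotient.quot N)); exact: reprK. Qed.

Lemma open_quot_pi (W : set (quotient_group N)) :
  open W = open (quot_pi @^-1` W).
Proof. by []. Qed.

End quotient_projection.

Lemma cardinality_eq (K L : Type) :
  [set: K] #= [set: L] -> cardinality K = cardinality L.
Proof.
move=> KL; apply: eq_sig_hprop => [C|/=]; first exact: Prop_irrelevance.
by apply/predeqP => M /=; rewrite (card_eqr KL).
Qed.

Lemma cardinality_inj (K L : Type) :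
  cardinality K = cardinality L -> [set: K] #= [set: L].
Proof.
move=> /(congr1 (@proj1_sig _ _))/= /predeqP/(_ K) [+ _].
by apply; exact: card_eqxx.
Qed.

(** The relation [cardinal_le] refers to representatives in a fixed universe,
    which may be smaller than the universe of the bases of a quotient of the
    group. Such bases are compared to other types through an equipotent set of
    elements of a small type. *)
Lemma small_copy (T U : Type) (f : T -> U) : injective f ->
  [set: T] #= [set: {u | range f u}].
Proof.
move=> fI; apply: card_esym; rewrite card_eq_le; apply/andP; split; apply/card_le_injP.
  have gE (u : {u | range f u}) : exists t, f t = sval u.
    by case: u => u [t tT tu]; exists t.
  have [g gP] := choice gE; exists g => u v guv; apply: sval_inj.
  by rewrite -gP -gP guv.
exists (fun t => exist _ (f t) (imageT f t)) => s t /(congr1 sval)/=; exact: fI.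
Qed.

(** The quotient by a subgroup [N] with the same elements as the axis of [j]. *)
Section weight.
Variables (R : realType) (J : set (nat -> bool)).
Variable I : (nat -> bool) -> set (nat -> bool).
Hypothesis J2 : exists j j', [/\ J j, J j' & j != j'].
Hypothesis I0 : forall j, J j -> I j !=set0.
Local Notation X := (nat -> bool).
Local Notation valid := (admissible J I).
Local Notation G := (subgroup (@gspan R J I)).
Local Notation axis := (axis R J I).

Variables (N : zmodClosed G) (j : X).
Hypothesis (Jj : J j) (NE : [set` N] = [set` axis j]).

Let NP (g : G) : g \in N <-> (forall x, valid x -> owner x = j -> val g x = 0).
Proof. by rewrite -axisP; have := congr1 (@^~ g) NE => /= ->. Qed.

Local Notation Q := (quotient_group N).
Local Notation quot_pi := (@quot_pi _ N).

Let on_axis x := valid x /\ owner x = j.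

Let quot_pi_val (g h : G) x :
  on_axis x -> quot_pi g = quot_pi h -> val g x = val h x.
Proof.
move=> [vx xj] /quot_piP/NP/(_ x vx xj); rewrite val_subgroupB => /eqP.
by rewrite subr_eq0 => /eqP.
Qed.

(* A neighborhood of [h] saturated for [N] contains one that constrains only
   coordinates owned by [j]: the other coordinates of [h'] are brought close to
   those of [h] by adding a multiple of the generator of [j], which vanishes at
   the coordinates owned by [j]. *)
Let shrink (W : set Q) (h : G) : open W -> W (quot_pi h) -> exists xs e,
  [/\ 0 < e, {in xs, forall x, on_axis x} &
      forall h', near_on xs e (val h) (val h') -> W (quot_pi h')].
Proof.
move=> oW Wh; have /nbhs_subgroup[xs [e [e0 eW]]] : nbhs h (quot_pi @^-1` W).
  exact: open_nbhs_nbhs.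
exists [seq x <- xs | `[< on_axis x >]], e; split => //.
  by move=> x; rewrite mem_filter => /andP[/asboolP].
move=> h' hh'; have [E EP] := @generator_lift R J I; have EjE := EP _ Jj.
have [|n nP] := @kronecker_approx R J I (E j) (h - h')
    [seq x <- xs | ~~ `[< on_axis x >]] e e0.
  move=> x; rewrite mem_filter => /andP[/asboolPn nx _] Ejx.
  have [vx|/invalid0-> //] := pselect (valid x).
  have := generator_neq0 R Jj vx; rewrite -EjE Ejx eqxx => h0.
  by case: nx; split=> //; apply/eqP; apply: contraT => /h0.
have -> : quot_pi h' = quot_pi (h' + E j *+ n).
  apply/quot_piP; rewrite opprD addrA subrr sub0r rpredN rpredMn //.
  by apply/NP => x _ xj; rewrite EjE generator_own0.
apply: eW => x xin; rewrite val_subgroupD.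
have [xa|xa] := boolP `[< on_axis x >].
  have -> : val (E j *+ n) x = 0.
    by rewrite val_subgroupMn EjE generator_own0 ?mul0rn //; have /asboolP[] := xa.
  by rewrite addr0; apply: hh'; rewrite mem_filter xa.
have := nP x; rewrite mem_filter xa => /(_ xin); rewrite val_subgroupB.
by rewrite opprB addrA [val (E j *+ n) x + _]addrC.
Qed.

Let disk (g : G) xs e : set Q :=
  [set q | exists2 h, quot_pi h = q & near_on xs e (val g) (val h)].

Let disk_open g xs e : {in xs, forall x, on_axis x} -> open (disk g xs e).
Proof.
move=> xsj; rewrite open_quot_pi.
rewrite (_ : _ @^-1` _ = [set h | near_on xs e (val g) (val h)]).
  exact: open_near_on.
apply/seteqP; split=> h /=; last by exists h.
by move=> [h' /quot_pi_val hh' gh'] x xin; rewrite -hh' ?gh' //; exact: xsj.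
Qed.

Let coord (i : {i | I j i}) : X := interleave (j, sval i).

Let coord_axis i : on_axis (coord i).
Proof.
by case: i => i Ii; rewrite /on_axis /coord /admissible /owner interleaveK.
Qed.

Let coord_inj : injective coord.
Proof. by move=> i i' /(can_inj interleaveK)[/sval_inj]. Qed.

Let coord_surj x : on_axis x -> exists i, coord i = x.
Proof.
move=> [[_ Ix] xj]; rewrite xj in Ix; exists (exist _ _ Ix).
by rewrite /coord /= -xj -[LHS]/(interleave (deinterleave x)) deinterleaveK.
Qed.

Let n1_gt0 n : 0 < n.+1%:R^-1 :> R. Proof. by rewrite invr_gt0. Qed.

(** The discs of radius [1 / (n + 1)], centered at the multiples of an element
    generating a dense subgroup and bearing on finitely many coordinates owned
    by [j], form a basis. *)
Lemma weight_upper : infinite_set [set: {i | I j i}] ->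
  exists2 B : set (set Q), basis B & exists f : B -> {i | I j i}, injective f.
Proof.
move=> Iinf; have [g gP] := nonvanishing_element R J2 I0.
pose D (p : seq {i | I j i} * (nat * nat)) :=
  disk (g *+ p.2.1) (map coord p.1) p.2.2.+1%:R^-1.
have Dax s : {in map coord s, forall x, on_axis x}.
  by elim: s => [//|i s IH] x; rewrite inE => /orP[/eqP->|/IH//]; exact: coord_axis.
exists (range D); last first.
  have DE (U : range D) : exists p, D p = set_val U.
    by have [p _ pU] := set_mem (valP U); exists p.
  have [d dP] := choice DE.
  have [f fI] := seq_code_exists (nat * nat)%type Iinf.
  exists (fun U => f ([seq (i, (0, 0)) | i <- (d U).1], (d U).2)%N) => U U'.
  move=> /fI[/(congr1 (map fst)) d1 d2]; move: d1; rewrite -!map_comp !map_id => d1.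
  apply: val_inj; rewrite -[LHS]dP -[RHS]dP; congr D.
  by rewrite [LHS]surjective_pairing [RHS]surjective_pairing d1 d2.
split=> [_ [p _ <-]|q W]; first by apply: disk_open; exact: Dax.
have [h <-{q}] := quot_pi_surj q.
rewrite nbhsE => -[W' [oW' W'h] W'W].
have [xs [e [e0 xsj eW]]] := shrink oW' W'h.
have [s sE] : exists s, map coord s = xs.
  elim: xs xsj {eW} => [|x xs IH] xsj; first by exists [::].
  have [s sE] := IH (fun y yxs => xsj y (mem_behead (s := x :: xs) yxs)).
  have [i ix] := coord_surj (xsj x (mem_head _ _)).
  by exists (i :: s); rewrite /= ix sE.
pose n := Num.bound (2 / e).
have ne : n.+1%:R^-1 < e / 2.
  rewrite -[e / 2]invrK ltf_pV2 ?posrE ?invr_gt0 ?divr_gt0 // invf_div.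
  apply: lt_trans (archi_boundP _) _; first by rewrite divr_ge0 // ltW.
  by rewrite ltr_nat.
have [m mP] := @kronecker_approx R J I g h xs _ (n1_gt0 n) (fun x xin gx0 =>
  match (elimN eqP (gP x (xsj x xin).1)) gx0 with end).
exists (D (s, (m, n))).
  split; first by exists (s, (m, n)).
  exists h => // x /=; rewrite sE => xin; rewrite -cdistN opprB; exact: mP.
move=> _ [h' <- hh']; apply/W'W/eW => x xin.
have := hh' x; rewrite /= sE => /(_ xin) h1; have h2 := mP x xin.
apply: le_lt_trans (cdist_tri _ (val (g *+ m) x) _) _.
by rewrite [e]splitr ltrD // (lt_trans _ ne).
Qed.

(** Each [i] is sent to a basic neighborhood of zero contained in the unit disc
    at the coordinate [(j, i)]. The fibers are finite because a neighborhood of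
    zero constrains finitely many coordinates, and contains elements whose value
    at any other coordinate is close to [- 1]. *)
Lemma weight_lower (B : set (set Q)) : infinite_set [set: {i | I j i}] ->
  basis B -> exists f : {i | I j i} -> B, injective f.
Proof.
move=> Iinf [Bo Bn]; have [g gP] := nonvanishing_element R J2 I0.
have WE i : exists W : B, set_val W (quot_pi 0) /\
    set_val W `<=` disk 0 [:: coord i] 1.
  have oD : open (disk 0 [:: coord i] 1).
    by apply: disk_open => x; rewrite inE => /eqP->; exact: coord_axis.
  have D0 : disk 0 [:: coord i] 1 (quot_pi 0).
    by exists 0 => // x _; rewrite subrr cdist0.
  have [W [BW W0] WD] := Bn _ _ (open_nbhs_nbhs (conj oD D0)).
  by exists (SigSub (mem_set BW)).
have [w wP] := choice WE; apply: (finite_fibers_inj (f := w)) => // W.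
have [[i0 wi0]|nw] := pselect (exists i, w i = W); last first.
  apply: (@sub_finite_set _ _ set0) => // i /= wi.
  by apply: nw; exists i.
have W0 : set_val W (quot_pi 0) by rewrite -wi0; exact: (wP i0).1.
have oW : open (set_val W : set Q) by apply: Bo; exact/set_mem/(valP W).
have [xs [e [e0 xsj eW]]] := shrink oW W0.
apply: (@sub_finite_set _ _ (coord @^-1` [set` xs])); last first.
  apply: (card_le_finite _ (finite_seq xs)).
  by apply: card_ge_preimage => x y _ _; exact: coord_inj.
move=> i /= wi; apply: contrapT => /negP xi.
pose theta x : R := if x == coord i then 2^-1 else 0.
have d0 : 0 < Num.min e 1 by rewrite lt_min e0 ltr01.
have [|n nP] := @kronecker_gspan R J I g (coord i :: xs) theta _ d0.
  by move=> x; rewrite inE => /orP[/eqP->|/xsj[]/gP//]; apply: gP; case: (coord_axis i).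
have : set_val W (quot_pi (g *+ n)).
  apply: eW => x xin; have xni : x != coord i by apply: contraNneq xi => <-.
  have := nP x; rewrite inE xin orbT /theta (negPf xni) cis0 => /(_ isT).
  by rewrite val_subgroupMn lt_min => /andP[].
rewrite -wi => /(wP i).2 [h gh /(_ (coord i) (mem_head _ _))].
rewrite subr0 (quot_pi_val (coord_axis i) gh) val_subgroupMn => c1.
have := nP (coord i) (mem_head _ _); rewrite /theta eqxx lt_min => /andP[_ c2].
have := cdist_tri (cis 2^-1) (val g (coord i) *+ n) (0 : circle R).
rewrite !subr0 cdist_half leNgt => /negP; apply.
by rewrite [ltRHS](_ : 2 = 1 + 1) // ltrD // -cdistN opprB.
Qed.

Lemma axis_quotient_infinite : infinite_set [set: Q].
Proof.
apply/infinite_injP; have [j' Jj' jj'] := another_index J2 j.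
have [E EP] := @generator_lift R J I; have EE := EP _ Jj'.
have [x vx xj] := valid_ex I0 Jj.
exists (fun n => quot_pi (E j' *+ n)).
suff key m n : quot_pi (E j' *+ m) = quot_pi (E j' *+ (m + n)) -> n = 0.
  move=> m n mn; have [le_mn|/ltnW le_nm] := leqP m n.
    move: mn; rewrite -{1}(subnKC le_mn) => /key/eqP; rewrite subn_eq0 => le_nm.
    by apply/eqP; rewrite eqn_leq le_mn.
  move/esym: mn; rewrite -{1}(subnKC le_nm) => /key/eqP; rewrite subn_eq0 => le_mn.
  by apply/eqP; rewrite eqn_leq le_mn.
move=> /esym/(quot_pi_val (conj vx xj)); rewrite mulrnDr.
rewrite val_subgroupD -[RHS]add0r addrC => /addIr.
rewrite val_subgroupMn; case: n => // n /torsion_free; rewrite EE => g0.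
have := generator_neq0 R Jj' vx; rewrite xj eq_sym => /(_ jj').
by rewrite g0 eqxx.
Qed.

End weight.

Lemma powerset_small_copy (T : Type) (U : Type) (f : T -> U) (B : set (set T)) :
  injective f -> exists S : set (U -> bool), [set: B] #= [set: {u | S u}].
Proof.
move=> fI; pose g (A : B) : U -> bool := fun u => `[< exists2 t, set_val A t & f t = u >].
exists (range g); apply: small_copy.
have sub (A A' : B) : g A = g A' -> set_val A `<=` set_val A'.
  move=> AA' t At; have : g A (f t) by apply/asboolP; exists t.
  by rewrite AA' => /asboolP[s A's /fI <-].
by move=> A A' AA'; apply/val_inj/seteqP; split; exact: sub.
Qed.

(** * Choice of the parameters *)

Local Notation X := (nat -> bool).

Lemma cardinal_le_anti k l : cardinal_le k l -> cardinal_le l k -> k = l.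
Proof.
move=> [K [L [-> -> KL]]] [L' [K' [/cardinality_inj LL' /cardinality_inj KK' LK]]].
apply: cardinality_eq; rewrite card_eq_le KL /=.
by rewrite (card_le_eql LL') (card_le_eqr KK').
Qed.

Lemma weight_unique (T : topologicalType) k l :
  is_weight T k -> is_weight T l -> k = l.
Proof.
move=> [[B bB <-] kmin] [[B' bB' <-] lmin].
by apply: cardinal_le_anti; [exact: kmin|exact: lmin].
Qed.

Lemma subset_of_cardinal k : cardinal_le k continuum ->
  exists S : set X, cardinality {x | S x} = k.
Proof.
move=> [K [L [-> /cardinality_inj XL KL]]].
have [f fI] : exists f : K -> X, injective f.
  by apply/card_le_injP; rewrite (card_le_eqr XL).
by exists (range f); apply/esym/cardinality_eq/small_copy.
Qed.

Lemma trivial_quotient_finite (V : topologicalZmodType) (N : zmodClosed V) :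
  [set` N] = setT -> finite_set [set: quotient_group N].
Proof.
move=> NT; apply: (@sub_finite_set _ _ [set quot_pi N 0]) => // q _.
have [x <-] := quot_pi_surj q; apply/quot_piP.
by have : [set` N] (x - 0) by rewrite NT.
Qed.

(** The quotient by the whole group has a basis with one element. *)
Lemma trivial_quotient_weight (V : topologicalZmodType) (N : zmodClosed V) k :
  [set` N] = setT -> is_weight (quotient_group N) k -> ~ cardinal_le aleph0 k.
Proof.
move=> NT [_ kmin] [K [L [/cardinality_inj nK kL KL]]].
have QE (q q' : quotient_group N) : q = q'.
  have [x <-] := quot_pi_surj q; have [y <-] := quot_pi_surj q'; apply/quot_piP.
  by have : [set` N] (x - y) by rewrite NT.
have bT : basis [set setT : set (quotient_group N)].
  split=> [_ ->|q W /nbhs_singleton Wq]; first exact: openT.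
  by exists setT => // q' _; rewrite (QE q' q).
have [K' [L' [kK' BL' KL']]] := kmin _ bT.
have LK' : [set: L] #= [set: K'] by apply: cardinality_inj; rewrite -kL.
have L'B : [set: L'] #= [set: [set setT : set (quotient_group N)]].
  by apply: cardinality_inj.
have : [set: nat] #<= [set: [set setT : set (quotient_group N)]].
  rewrite (card_le_eql nK) -(card_le_eqr L'B); apply: card_le_trans KL _.
  by rewrite (card_le_eql LK').
rewrite (card_le_eqr (card_setT _)) => /infiniteP; apply; exact: finite_set1.
Qed.

(** The group has at most continuum many elements: an element is determined by
    the finite sequence of its coefficients. *)
Lemma gspan_code (R : realType) (J : set X) (I : X -> set X) :
  exists f : subgroup (@gspan R J I) -> X, injective f.
Proof.
have Xinf : infinite_set [set: X].
  apply/infinite_injP; exists (fun n m => n == m) => m n mn.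
  by have := congr1 (@^~ m) mn; rewrite /= eqxx => /esym/eqP ->.
have [f fI] := @seq_code_exists X int Xinf.
have gE (g : subgroup (gspan R J I)) : exists p : seq (X * int),
    val g = \sum_(x <- p) generator R J I x.1 *~ x.2.
  have [s [c [_ _ gE]]] := gspan_combP g; exists [seq (j, c j) | j <- s].
  by rewrite big_map.
have [p pP] := choice gE.
exists (fun g => f (p g, 0)) => g h /fI[gh].
by apply/val_inj; rewrite pP gh -pP.
Qed.

Section weight_of_axis_quotient.
Variables (R : realType) (J : set X) (I : X -> set X).
Hypothesis J2 : exists j j', [/\ J j, J j' & j != j'].
Hypothesis I0 : forall j, J j -> I j !=set0.

Lemma axis_weight (N : zmodClosed (subgroup (@gspan R J I))) j :
  J j -> [set` N] = [set` axis R J I j] -> infinite_set [set: {i | I j i}] ->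
  is_weight (quotient_group N) (cardinality {i | I j i}).
Proof.
move=> Jj NE Iinf.
have [f fI] : exists f : quotient_group N -> X, injective f.
  have [c cI] := gspan_code R J I.
  have [r rP] := choice (@quot_pi_surj _ N).
  by exists (c \o r) => q q' /cI rq; rewrite -(rP q) rq rP.
split.
  have [B bB [u uI]] := weight_upper J2 I0 Jj NE Iinf; exists B => //.
  have [v vI] := weight_lower J2 I0 Jj NE Iinf bB.
  by apply: cardinality_eq; rewrite card_eq_le; apply/andP; split;
    apply/card_le_injP; [exists u|exists v].
move=> B bB; have [v vI] := weight_lower J2 I0 Jj NE Iinf bB.
have [S BS] := powerset_small_copy B fI.
exists {i | I j i}, {u | S u}; split => //; first exact: cardinality_eq.
by rewrite -(card_le_eqr BS); apply/card_le_injP; exists v.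
Qed.

End weight_of_axis_quotient.

Theorem theorem3p7 (R : realType) (E : set cardinal)
    (mu : cardinal -> cardinal) :
  E !=set0 ->
  (forall k, E k -> cardinal_le aleph0 k /\ cardinal_le k continuum) ->
  (forall k, E k -> mu k <> cardinality void /\ cardinal_le (mu k) continuum) ->
  (exists k l, [/\ E k, E l & k <> l]) \/
  (exists2 k, E = [set k] & cardinal_lt (cardinality unit) (mu k)) ->
  exists G : zmodClosed {ptws (nat -> bool) -> circle R},
    [/\ has_clopen_basis (subgroup G), monothetic (subgroup G),
        free_abelian (subgroup G), QW (subgroup G) = E &
        forall k, E k ->
          cardinality (proper_kernels_of_weight (subgroup G) k) = mu k].
Proof.
move=> E0 Ec muc E2.
have repX (k : cardinal) : exists S : set X,
    cardinal_le k continuum -> cardinality {x | S x} = k.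
  have [/subset_of_cardinal[S kS]|nk] := pselect (cardinal_le k continuum).
    by exists S.
  by exists set0.
have [rep repE] := choice repX.
have [W woW] := well_ordering_principle (nat -> bool).
have [code0 code0P] := subset_code_exists woW.
(* the first component keeps the codes [None] and [Some x] apart *)
pose code k := if code0 (rep k) is Some x then interleave (xpredT, x)
  else interleave (xpred0, xpred0).
have codeI k l : E k -> E l -> code k = code l -> k = l.
  move=> Ek El kl; have kl0 : code0 (rep k) = code0 (rep l).
    move: kl; rewrite /code; case: (code0 _) => [x|]; case: (code0 _) => [y|] //.
    - by move=> /(can_inj interleaveK)[->].
    - by move=> /(can_inj interleaveK)[/(congr1 (@^~ 0%N))].
    - by move=> /(can_inj interleaveK)[/(congr1 (@^~ 0%N))].
  rewrite -(repE k (Ec k Ek).2) -(repE l (Ec l El).2); apply: cardinality_eq.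
  by rewrite card_eq_le; apply/andP; split; apply/card_le_injP; apply: code0P.
pose J : set X := [set x | exists k, [/\ E k, code k = (deinterleave x).1 &
  rep (mu k) (deinterleave x).2]].
pose I (j : X) : set X := [set i | exists k, [/\ E k, code k = (deinterleave j).1 &
  rep k i]].
have IE k m : E k -> I (interleave (code k, m)) = rep k.
  move=> Ek; rewrite /I interleaveK /=; apply/seteqP; split=> i /=.
    by move=> [l [El /codeI <-]].
  by move=> ki; exists k.
have JE k m : E k -> rep (mu k) m -> J (interleave (code k, m)).
  by move=> Ek km; exists k; rewrite interleaveK.
have JP j : J j -> exists k m, [/\ E k, rep (mu k) m & j = interleave (code k, m)].
  move=> [k [Ek kj mj]]; exists k, (deinterleave j).2; split => //.
  by rewrite kj -surjective_pairing deinterleaveK.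
have repinf k : E k -> infinite_set [set: {i | rep k i}].
  move=> Ek; have [[K [L [/cardinality_inj nK kL KL]]] kc] := Ec k Ek.
  apply/infiniteP; rewrite (card_le_eql nK); apply: card_le_trans KL _.
  have /cardinality_inj LS : cardinality L = cardinality {i | rep k i}.
    by rewrite repE.
  by rewrite (card_le_eql LS).
have Iinf j : J j -> infinite_set [set: {i | I j i}].
  by move=> /JP[k [m [Ek _ ->]]]; rewrite IE //; exact: repinf.
have I0 j : J j -> I j !=set0.
  by move=> /Iinf /infinite_setN0 [[i Ii] _]; exists i.
have rep0 k : E k -> exists m, rep (mu k) m.
  move=> Ek; apply: contrapT => /forallNP nm; have [mu0 mul] := muc k Ek.
  apply: mu0; rewrite -(repE (mu k) mul); apply: cardinality_eq.
  rewrite card_eq_le; apply/andP; split; apply/card_le_injP.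
    have f (x : {x | rep (mu k) x}) : void by case: x => x mx; case: (nm x).
    by exists f => -[x mx]; case: (nm x).
  by exists (fun v : void => match v with end) => -[].
(* two indices come from distinct elements of [E], or from distinct elements of
   [rep (mu k)] *)
have J2 : exists j j', [/\ J j, J j' & j != j'].
  case: E2 => [[k [l [Ek El kl]]]|[k EE [[K [L [_ _ _]] mu1]]]].
    have [m km] := rep0 _ Ek; have [m' lm'] := rep0 _ El.
    exists (interleave (code k, m)), (interleave (code l, m')).
    split; [exact: JE|exact: JE|]; apply/eqP => /(can_inj interleaveK)[].
    by move=> /(codeI _ _ Ek El).
  have Ek : E k by rewrite EE.
  have [m km] := rep0 _ Ek.
  have [[m' [km' mm']]|nm] := pselect (exists m', rep (mu k) m' /\ m != m').
    exists (interleave (code k, m)), (interleave (code k, m')).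
    split; [exact: JE|exact: JE|].
    by apply: contra_neq mm' => /(can_inj interleaveK)[].
  case: mu1; rewrite -(repE (mu k) (muc k Ek).2); apply: cardinality_eq.
  rewrite card_eq_le; apply/andP; split; apply/card_le_injP.
    by exists (fun _ => exist _ m km) => -[] [].
  have mU x : rep (mu k) x -> x = m.
    move=> kx; apply/eqP; apply: contraT => xm; case: nm; exists x.
    by rewrite eq_sym.
  exists (fun _ => tt) => -[x kx] [y ky] _; apply: eq_exist.
  by rewrite (mU x kx) (mU y ky).
have weightE (N : zmodClosed (subgroup (gspan R J I))) j k : J j ->
    [set` N] = [set` axis R J I j] ->
    is_weight (quotient_group N) k -> exists m,
    [/\ E k, rep (mu k) m & j = interleave (code k, m)].
  move=> Jj NE wk; have := axis_weight J2 I0 Jj NE (Iinf j Jj).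
  move=> /(weight_unique wk) ->; have [l [m [El lm ->]]] := JP j Jj.
  by exists m; rewrite IE // repE //; exact: (Ec l El).2.
have axisW k m : E k -> rep (mu k) m ->
    is_weight (quotient_group (axis R J I (interleave (code k, m)))) k.
  move=> Ek km; have Jj := JE _ _ Ek km.
  have := axis_weight J2 I0 Jj (erefl [set` axis R J I _]) (Iinf _ Jj).
  by rewrite IE // repE //; case: (Ec k Ek).
exists (gspan R J I); split.
- exact: gspan_clopen_basis.
- exact: gspan_monothetic.
- exact: gspan_free.
- apply/seteqP; split=> k.
    move=> [N [pN Ninf wk]].
    have [/trivial_quotient_finite//|[j Jj NE]] := closed_subgroupP I0 pN.
    by have [m []] := weightE _ _ _ Jj NE wk.
  move=> Ek; have [m km] := rep0 _ Ek; have Jj := JE _ _ Ek km.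
  exists (axis R J I (interleave (code k, m))); split.
  + exact: axis_proper.
  + exact: (axis_quotient_infinite J2 I0 Jj).
  + exact: axisW.
move=> k Ek; rewrite -[RHS](repE (mu k) (muc k Ek).2); apply: cardinality_eq.
rewrite card_eq_le; apply/andP; split; apply/card_le_injP.
  have AE (A : proper_kernels_of_weight (subgroup (gspan R J I)) k) :
      exists m : {m | rep (mu k) m},
      set_val A = [set` axis R J I (interleave (code k, sval m))].
    have [N [AN pN wk]] := set_mem (valP A).
    have [NT|[j Jj NE]] := closed_subgroupP I0 pN.
      by case: (trivial_quotient_weight NT wk); case: (Ec k Ek).
    have [m [_ km jE]] := weightE _ _ _ Jj NE wk.
    by exists (exist _ m km); rewrite /= -jE -NE.
  have [f fP] := choice AE; exists f => A A' AA'; apply: val_inj.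
  by have := fP A; rewrite AA' -fP.
have ker (m : {m | rep (mu k) m}) : proper_kernels_of_weight
    (subgroup (gspan R J I)) k [set` axis R J I (interleave (code k, sval m))].
  case: m => m km; exists (axis R J I (interleave (code k, m))).
  by split => //; [exact/axis_proper/JE|exact: axisW].
exists (fun m => SigSub (mem_set (ker m))) => m m' /(congr1 set_val)/=.
move=> /(axis_inj I0 (JE _ _ Ek (svalP m)) (JE _ _ Ek (svalP m'))).
by move=> /(can_inj interleaveK)[/sval_inj].
Qed.
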